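(* Let $k$ be a field and let $f:X\to Y$ be a morphism of real analytic manifolds. Quasi-injective sheaves on $X_{sa}$ are injective with respect to the functor $f_*:\mathrm{Mod}(k_{X_{sa}})\to\mathrm{Mod}(k_{Y_{sa}})$. Moreover the functor $f_*$ sends quasi-injective objects to quasi-injective objects.
   Context: The subanalytic site $X_{sa}$ is the category $\mathrm{Op}_{sa}(X)$ of open subanalytic subsets of $X$ with the topology in which a family $S$ of open subanalytic subsets of $U$ is a covering of $U$ if for every compact $K\subset X$ there is a finite $S_0\subset S$ with $K\cap\bigcup_{V\in S_0}V=K\cap U$. $\mathrm{Mod}(k_{X_{sa}})$ is the category of sheaves of $k$-vector spaces on $X_{sa}$. A real analytic map $f:X\to Y$ induces a morphism of sites $X_{sa}\to Y_{sa}$ and $\Gamma(V;f_*F)=\Gamma(f^{-1}(V);F)$. $\mathrm{Mod}^c_{\mathbb{R}\text{-}c}(k_X)$ is the category of $\mathbb{R}$-constructible sheaves on $X$ with compact support, embedded in $\mathrm{Mod}(k_{X_{sa}})$ by the direct image $\rho_*$ of the natural morphism of sites $\rho:X\to X_{sa}$. An object $F\in\mathrm{Mod}(k_{X_{sa}})$ is quasi-injective if $\mathrm{Hom}_{k_{X_{sa}}}(\cdot,F)$ is exact on $\mathrm{Mod}^c_{\mathbb{R}\text{-}c}(k_X)$, equivalently if for all relatively compact open subanalytic $V\subset U$ the restriction $\Gamma(U;F)\to\Gamma(V;F)$ is surjective; $\mathcal{J}_{X_{sa}}$ denotes the full subcategory of quasi-injective objects. A full subcategory $\mathcal{J}$ of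 an abelian category $\mathcal{C}$ is injective with respect to a left exact functor $\Phi$ on $\mathcal{C}$ if: every object of $\mathcal{C}$ embeds in an object of $\mathcal{J}$; for every exact $0\to F'\to F\to F''\to0$ in $\mathcal{C}$ with $F',F\in\mathcal{J}$ one has $F''\in\mathcal{J}$; and for every such exact sequence with $F',F,F''\in\mathcal{J}$ the sequence $0\to\Phi(F')\to\Phi(F)\to\Phi(F'')\to0$ is exact. *)

(* Defs.v *)
From HB Require Import structures.
From mathcomp Require Import all_boot all_order all_algebra.
From mathcomp Require Import all_classical all_reals all_analysis.
From mathcomp Require Import lra.
Set Implicit Arguments.
Unset Strict Implicit.
Unset Printing Implicit Defensive.
Import Order.TTheory GRing.Theory Num.Theory numFieldNormedType.Exports.
Local Open Scope classical_set_scope.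
Local Open Scope ring_scope.

Section Analytic.
Context {R : realType}.

(* Partial sums, over the multi-indices in [0, K]^n, of the power series
   sum_alpha c_alpha h^alpha. *)
Definition psum n (c : {ffun 'I_n -> nat} -> R) (h : 'I_n -> R) (K : nat) : R :=
  \sum_(a : {ffun 'I_n -> 'I_K.+1})
     c [ffun i => nat_of_ord (a i)] * \prod_i h i ^+ a i.

Definition analytic_at n (a : 'rV[R]_n) (g : 'rV[R]_n -> R) : Prop :=
  exists (c : {ffun 'I_n -> nat} -> R) (r M : R),
    [/\ 0 < r,
        forall K, psum (fun al => `|c al|) (fun=> r) K <= M
      & forall x, ball a r x ->
          psum c (fun i => x 0 i - a 0 i) K @[K --> \oo] --> g x].

Definition analytic_map_at n m (a : 'rV[R]_n) (g : 'rV[R]_n -> 'rV[R]_m) : Prop :=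
  forall j, analytic_at a (fun x => g x 0 j).

Lemma psumB n (c1 c2 : {ffun 'I_n -> nat} -> R) h K :
  psum (fun a => c1 a - c2 a) h K = psum c1 h K - psum c2 h K.
Proof. by rewrite /psum -sumrB; apply: eq_bigr => a _; rewrite mulrBl. Qed.

Lemma psumD n (c1 c2 : {ffun 'I_n -> nat} -> R) h K :
  psum (fun a => c1 a + c2 a) h K = psum c1 h K + psum c2 h K.
Proof. by rewrite /psum -big_split; apply: eq_bigr => a _; rewrite mulrDl. Qed.

Lemma psum_le n (c1 c2 : {ffun 'I_n -> nat} -> R) r1 r2 K :
  (forall a, 0 <= c1 a <= c2 a) -> 0 <= r1 <= r2 ->
  psum c1 (fun=> r1) K <= psum c2 (fun=> r2) K.
Proof.
move=> cP /andP[r0 rr]; apply: ler_sum => a _.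
have [c0 cc] := andP (cP [ffun i => nat_of_ord (a i)]).
apply: ler_pM => //; first by apply: prodr_ge0 => i _; exact: exprn_ge0.
apply: ler_prod => i _; rewrite exprn_ge0 //=.
by apply: lerXn2r => //; rewrite nnegrE // (le_trans r0).
Qed.

Lemma analytic_atB n (a : 'rV[R]_n) f g :
  analytic_at a f -> analytic_at a g -> analytic_at a (fun x => f x - g x).
Proof.
move=> [c1 [r1 [M1 [r10 b1 s1]]]] [c2 [r2 [M2 [r20 b2 s2]]]].
have m0 : 0 <= Num.min r1 r2 by rewrite le_min !ltW.
have m1 : Num.min r1 r2 <= r1 by rewrite ge_min lexx.
have m2 : Num.min r1 r2 <= r2 by rewrite ge_min lexx orbT.
exists (fun al => c1 al - c2 al), (Num.min r1 r2), (M1 + M2); split.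
- by rewrite lt_min r10.
- move=> K; apply: (@le_trans _ _
    (psum (fun al => `|c1 al| + `|c2 al|) (fun=> Num.min r1 r2) K)).
    by apply: psum_le; [move=> al; rewrite normr_ge0 ler_normB|rewrite m0 lexx].
  rewrite psumD lerD //; [apply: le_trans (b1 K)|apply: le_trans (b2 K)].
    by apply: psum_le; [move=> al; rewrite normr_ge0 lexx|rewrite m0].
  by apply: psum_le; [move=> al; rewrite normr_ge0 lexx|rewrite m0].
- move=> x bx; under eq_fun do rewrite psumB.
  by apply: cvgB; [apply: s1|apply: s2]; apply: le_ball bx.
Qed.

Definition pad n N (s : 'I_n -> 'I_N) (c : {ffun 'I_n -> nat} -> R)
    (al : {ffun 'I_N -> nat}) : R :=
  if [forall j, (j \in codom s) || (al j == 0%N)] then c [ffun i => al (s i)] else 0.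

Lemma psum_pad n N (s : 'I_n -> 'I_N) c h K : injective s ->
  psum (pad s c) h K = psum c (fun i => h (s i)) K.
Proof.
move=> sI; rewrite /psum.
pose P (a : {ffun 'I_N -> 'I_K.+1}) := [forall j, (j \in codom s) || (a j == ord0)].
pose ext (b : {ffun 'I_n -> 'I_K.+1}) : {ffun 'I_N -> 'I_K.+1} :=
  [ffun j => if [pick i | s i == j] is Some i then b i else ord0].
pose rst (a : {ffun 'I_N -> 'I_K.+1}) : {ffun 'I_n -> 'I_K.+1} := [ffun i => a (s i)].
have extE b i : ext b (s i) = b i.
  by rewrite ffunE; case: pickP => [j /eqP/sI ->//|/(_ i)]; rewrite eqxx.
have ext0 b j : j \notin codom s -> ext b j = ord0.
  move=> jn; rewrite ffunE; case: pickP => [i /eqP ij|//].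
  by move: jn; rewrite -ij codom_f.
transitivity (\sum_(a | P a) c [ffun i => nat_of_ord (rst a i)] *
                \prod_i h i ^+ a i).
  rewrite [RHS]big_mkcond; apply: eq_bigr => a _; rewrite /pad.
  have -> : [forall j, (j \in codom s) ||
      ([ffun i => nat_of_ord (a i)] j == 0%N)] = P a.
    by apply: eq_forallb => j; rewrite ffunE.
  case: ifP => _; last by rewrite mul0r.
  by congr (c _ * _); apply/ffunP => i; rewrite !ffunE.
rewrite (reindex_onto ext rst); last first.
  move=> a /forallP Pa; apply/ffunP => j; have := Pa j.
  have [/codomP[i ->] _|jn /= /eqP ->] := boolP (j \in codom s).
    by rewrite extE ffunE.
  by rewrite ext0.
apply: eq_big => [b|b _].
  apply/andP; split.
    apply/forallP => j; have [//|jn] := boolP (j \in codom s).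
    by rewrite ext0.
  by apply/eqP/ffunP => i; rewrite ffunE extE.
congr (c _ * _).
  by apply/ffunP => i; rewrite [RHS]ffunE [LHS]ffunE [rst _ _]ffunE extE.
rewrite (bigID (mem (codom s))) /= [X in _ * X]big1 ?mulr1; last first.
  by move=> j jn; rewrite ext0 // expr0.
rewrite -big_uniq /=; last by rewrite /codom /image_mem map_inj_uniq ?enum_uniq.
by rewrite big_map big_enum; apply: eq_bigr => i _; rewrite extE.
Qed.

Lemma analytic_at_colsub n N (s : 'I_n -> 'I_N) (a : 'rV[R]_N) g :
  injective s -> analytic_at (colsub s a) g ->
  analytic_at a (fun x => g (colsub s x)).
Proof.
move=> sI [c [r [M [r0 b cv]]]]; exists (pad s c), r, M; split=> //.
- move=> K; apply: le_trans (b K).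
  rewrite le_eqVlt -(psum_pad _ _ _ sI); apply/orP; left; apply/eqP.
  by apply: eq_bigr => al _; rewrite /pad; case: ifP; rewrite ?normr0.
- move=> x [_ bx].
  have /cv : ball (colsub s a) r (colsub s x).
    by split=> // i j; rewrite !mxE.
  rewrite (_ : (fun K => psum _ _ K) = (fun K => psum (pad s c) (fun i => x 0 i - a 0 i) K)) //.
  apply/funext => K.
  by rewrite psum_pad //; apply: eq_bigr => al _; congr (_ * _);
    apply: eq_bigr => i _; rewrite !mxE.
Qed.

Lemma analytic_at_cst n (a : 'rV[R]_n) (b : R) : analytic_at a (fun=> b).
Proof.
have [s s0] : exists s : 'I_0 -> 'I_n, injective s.
  by exists (fun i : 'I_0 => False_rect _ (elimF idP (ltn0 i) (ltn_ord i))); case.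
apply: (analytic_at_colsub (g := fun=> b) s0).
have P0 (c : R) h K : psum (n := 0) (fun=> c) h K = c.
  rewrite /psum (big_pred1 [ffun=> ord0]); first by rewrite big_ord0 mulr1.
  by move=> x; apply/esym/eqP/ffunP; case.
exists (fun=> b), 1, `|b|; split=> //; first by move=> K; rewrite P0.
by move=> x _; under eq_fun do rewrite P0; exact: cvg_cst.
Qed.

Lemma psum1 (c : {ffun 'I_1 -> nat} -> R) h K :
  psum c h K = \sum_(i < K.+1) c [ffun=> nat_of_ord i] * h ord0 ^+ i.
Proof.
rewrite /psum (reindex (fun i : 'I_K.+1 => [ffun _ : 'I_1 => i])) /=.
  apply: eq_bigr => i _; congr (c _ * _); last by rewrite big_ord1 ffunE.
  by apply/ffunP => j; rewrite !ffunE.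
exists (fun f => f ord0) => [i _|f _]; first by rewrite ffunE.
by apply/ffunP => j; rewrite ffunE (ord1 j).
Qed.

Lemma analytic_at_coord n (a : 'rV[R]_n) (i : 'I_n) :
  analytic_at a (fun x => x 0 i).
Proof.
have s1 : injective (fun _ : 'I_1 => i) by move=> x y _; rewrite !ord1.
suff : analytic_at (colsub (fun _ : 'I_1 => i) a) (fun x => x 0 0).
  move/(analytic_at_colsub s1).
  by congr analytic_at; apply/funext => x; rewrite !mxE.
move: (colsub _ _) => {}a.
pose c (al : {ffun 'I_1 -> nat}) : R :=
  if al ord0 is k.+1 then (k == 0%N)%:R else a 0 0.
have cS (f : R -> R) h K : f 0 = 0 ->
  psum (fun al => f (c al)) h K.+1 = f (a 0 0) + f 1 * h ord0.
  move=> f0; rewrite psum1 !big_ord_recl big1 => [|j _].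
    by rewrite /c !ffunE /= addr0 expr0 mulr1 expr1.
  by rewrite /c ffunE /= f0 mul0r.
exists c, 1, (`|a 0 0| + 1); split=> //.
  case=> [|K]; last by rewrite cS ?normr0 // normr1 mulr1.
  by rewrite psum1 big_ord1 /c ffunE expr0 mulr1 lerDl.
move=> x _; apply/cvg_ballP => e e0; near=> K.
have [K' ->] : exists K', K = K'.+1.
  by exists K.-1; rewrite prednK //; near: K; exact: nbhs_infty_gt.
rewrite (cS id) // mul1r addrC subrK; exact: ballxx.
Unshelve. all: by end_near. Qed.

End Analytic.

Section Semianalytic.
Context {R : realType}.

(* The smallest family of subsets of U containing the sets {f > 0}, f analytic
   on U, and stable under finite intersections and complements. *)
Inductive semianalytic_in n (U : set 'rV[R]_n) : set 'rV[R]_n -> Prop :=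
| sa_pos f of (forall a, U a -> analytic_at a f) :
    semianalytic_in U (U `&` [set x | 0 < f x])
| sa_diff A of semianalytic_in U A : semianalytic_in U (U `\` A)
| sa_setI A B of semianalytic_in U A & semianalytic_in U B :
    semianalytic_in U (A `&` B).

Definition semianalytic n (A : set 'rV[R]_n) : Prop :=
  forall p, exists U, [/\ open U, U p & semianalytic_in U (U `&` A)].

Lemma semianalytic_in_preimage n N (s : 'I_n -> 'I_N) (U A : set 'rV[R]_n)
    (V : set 'rV[R]_N) : injective s ->
  semianalytic_in U A -> V `<=` colsub s @^-1` U ->
  semianalytic_in V (V `&` colsub s @^-1` A).
Proof.
move=> sI AU VU; elim: AU => [f fa|{}A _ IA|{}A B _ IA _ IB].
- have := @sa_pos N V (fun x => f (colsub s x)).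
  rewrite (_ : _ `&` _ = V `&` [set x | 0 < f (colsub s x)]); last first.
    by apply/seteqP; split => x [Vx]; [case|move=> fx; split => //; split => //; exact: VU].
  apply=> a Va; apply: analytic_at_colsub => //; apply: fa; exact: VU.
- rewrite (_ : _ `&` _ = V `\` (V `&` colsub s @^-1` A)); first exact: sa_diff.
  apply/seteqP; split => x; first by move=> [Vx [_ nA]]; split=> // -[].
  by move=> [Vx nA]; split=> //; split; [exact: VU|move=> Ax; apply: nA].
- rewrite (_ : _ `&` _ = (V `&` colsub s @^-1` A) `&` (V `&` colsub s @^-1` B)).
    exact: sa_setI.
  by apply/seteqP; split => x; [move=> [? []]|move=> [[? ?] []]].
Qed.

Lemma semianalytic_inW n (U V A : set 'rV[R]_n) :
  semianalytic_in U A -> V `<=` U -> semianalytic_in V (V `&` A).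
Proof.
move=> AU VU; have idI : injective (@id 'I_n) by [].
have := semianalytic_in_preimage (V := V) idI AU.
have E (x : 'rV[R]_n) : colsub id x = x by apply/rowP => j; rewrite mxE.
have E' (B : set 'rV[R]_n) : colsub id @^-1` B = B.
  by apply/funext => x; rewrite -[in RHS](E x).
by rewrite !E'; exact.
Qed.

Lemma semianalytic_in0 n (U : set 'rV[R]_n) : semianalytic_in U set0.
Proof.
rewrite (_ : set0 = U `&` [set x | (0 : R) < 0]).
  by apply: (@sa_pos _ _ (fun=> 0)) => a _; exact: analytic_at_cst.
by apply/seteqP; split => // x [_] /=; rewrite ltxx.
Qed.

Lemma semianalytic_inT n (U : set 'rV[R]_n) : semianalytic_in U U.
Proof. by rewrite -[X in semianalytic_in _ X]setD0; apply/sa_diff/semianalytic_in0. Qed.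

Lemma semianalytic_in_eq n (U : set 'rV[R]_n) f g :
  (forall a, U a -> analytic_at a f) -> (forall a, U a -> analytic_at a g) ->
  semianalytic_in U (U `&` [set x | f x = g x]).
Proof.
move=> fa ga.
have := sa_setI (sa_diff (sa_pos (fun a Ua => analytic_atB (fa a Ua) (ga a Ua))))
                (sa_diff (sa_pos (fun a Ua => analytic_atB (ga a Ua) (fa a Ua)))).
congr semianalytic_in; apply/seteqP; split => x /=.
  move=> [[Ux h1] [_ h2]]; split=> //; apply/eqP; rewrite eq_le.
  rewrite -subr_le0 leNgt; apply/andP; split; first by apply/negP => ?; apply: h1.
  by rewrite -subr_le0 leNgt; apply/negP => ?; apply: h2.
by move=> [Ux ->]; split; split => // -[_]; rewrite subrr ltxx.
Qed.

Lemma semianalytic_in_all n (U : set 'rV[R]_n) m (A : 'I_m -> set 'rV[R]_n) :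
  (forall i, semianalytic_in U (U `&` A i)) ->
  semianalytic_in U (U `&` [set x | forall i, A i x]).
Proof.
move=> AP; suff H (s : seq 'I_m) :
    semianalytic_in U (U `&` [set x | forall i, i \in s -> A i x]).
  have := H (enum 'I_m); congr (semianalytic_in _ (_ `&` _)).
  by apply/seteqP; split => x /= h i *; apply: h; rewrite ?mem_enum.
elim: s => [|i s IH].
  rewrite (_ : _ `&` _ = U); first exact: semianalytic_inT.
  by apply/seteqP; split => x // [].
have := sa_setI (AP i) IH; congr semianalytic_in; apply/seteqP; split => x /=.
  move=> [[Ux Ax] [_ h]]; split=> // j; rewrite inE => /predU1P[->//|]; exact: h.
move=> [Ux h]; split; split => //; first by apply: h; rewrite mem_head.
by move=> j js; apply: h; rewrite inE js orbT.
Qed.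

End Semianalytic.

(* An empty space carries no chart, as [chart_inv] is total. *)
Record chart (R : realType) (X : topologicalType) := Chart {
  chart_dim : nat;
  chart_dom : set X;
  chart_fun :> X -> 'rV[R]_chart_dim;
  chart_inv : 'rV[R]_chart_dim -> X;
  chart_dom_open : open chart_dom;
  chart_img_open : open (chart_fun @` chart_dom);
  chart_funK : forall x, chart_dom x -> chart_inv (chart_fun x) = x;
  chart_fun_cont : forall x, chart_dom x -> chart_fun @ x --> chart_fun x;
  chart_inv_cont : forall x, chart_dom x ->
    chart_inv @ chart_fun x --> x }.

Arguments chart_inv {R X} c _.
Arguments chart_dom {R X} c _.

(* The dimension is only required to be locally constant. *)
Record manifold (R : realType) := Manifold {
  space :> topologicalType;
  atlas : set (chart R space);
  manifold_hausdorff : hausdorff_space space;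
  manifold_countable : @second_countable space;
  atlas_cover : forall x, exists2 c, atlas c & chart_dom c x;
  atlas_compat : forall c d x, atlas c -> atlas d ->
    chart_dom c x -> chart_dom d x ->
    analytic_map_at (c x) (fun u => d (chart_inv c u)) }.

Record morphism (R : realType) (X Y : manifold R) := Morphism {
  mfun :> X -> Y;
  mfun_cont : continuous mfun;
  mfun_analytic : forall c d x, atlas c -> atlas d ->
    chart_dom c x -> chart_dom d (mfun x) ->
    analytic_map_at (c x) (fun u => d (mfun (chart_inv c u))) }.

(* A is subanalytic if every point has a neighbourhood in which A is, in a
   chart, the projection of a relatively compact semianalytic subset of
   R^n x R^m. *)
Definition subanalytic (R : realType) (X : manifold R) (A : set X) : Prop :=
  forall x : X, exists (c : chart R X) (m : nat) (S : set 'rV[R]_(chart_dim c + m)),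
    [/\ atlas c, chart_dom c x, semianalytic S, bounded_set S
      & \forall y \near x, A y <-> exists t, S (row_mx (c y) t)].

Section SubanalyticPreimage.
Context {R : realType}.

Lemma colsub_cont n N (s : 'I_n -> 'I_N) :
  continuous (colsub s : 'rV[R]_N -> 'rV[R]_n).
Proof.
move=> a A /nbhs_ballP[e /= e0 eA]; apply/nbhs_ballP; exists e => //= x [_ ax].
by apply: eA; split=> // i j; rewrite !mxE.
Qed.

Lemma rV_entry_le n (w : 'rV[R]_n) i : `|w 0 i| <= `|w|.
Proof.
rewrite [leRHS]/Num.norm /= mx_normrE.
exact: (@le_bigmax _ _ _ _ (fun ij => `|w ij.1 ij.2|) (0, i)).
Qed.

Lemma rV_norm_le n (w : 'rV[R]_n) M : 0 <= M -> (forall i, `|w 0 i| <= M) -> `|w| <= M.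
Proof.
move=> M0 wM; rewrite [leLHS]/Num.norm /= mx_normrE.
by apply/bigmax_leP; split=> // -[i j] _ /=; rewrite (ord1 i).
Qed.

(* Semianalyticity is preserved because the graph of the map, read in charts,
   is part of the set to be projected. *)
Lemma local_projection (X Y : topologicalType) (c : chart R X) (d : chart R Y)
    (f : X -> Y) (x : X) (B : set Y) m (S : set 'rV[R]_(chart_dim d + m)) :
  chart_dom c x -> chart_dom d (f x) -> f @ x --> f x ->
  (forall x', chart_dom c x' -> chart_dom d (f x') ->
     analytic_map_at (c x') (fun u => d (f (chart_inv c u)))) ->
  semianalytic S -> bounded_set S ->
  (\forall y \near f x, B y <-> exists t, S (row_mx (d y) t)) ->
  exists m' (S' : set 'rV[R]_(chart_dim c + m')),
   [/\ semianalytic S', bounded_set S'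
     & \forall y \near x, B (f y) <-> exists t, S' (row_mx (c y) t)].
Proof.
move=> cx dfx fc fa Ssa Sb SB; set n := chart_dim c; set n' := chart_dim d.
pose F u := d (f (chart_inv c u)); set u0 := c x.
have [r r0 rP] : exists2 r : R, 0 < r & forall u, ball u0 r u ->
    exists x', [/\ chart_dom c x', u = c x' & chart_dom d (f x')].
  have : \forall u \near u0, exists x', [/\ chart_dom c x', u = c x' & chart_dom d (f x')].
    near=> u.
    have [x' cx' ux'] : (c @` chart_dom c) u.
      by near: u; apply: open_nbhs_nbhs; split; [exact: chart_img_open|exists x].
    exists x'; split=> //; rewrite -(chart_funK cx') ux'.
    near: u; apply: (cvg_comp _ _ (chart_inv_cont cx) fc).
    by apply: open_nbhs_nbhs; split => //; exact: chart_dom_open.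
  by move=> /nbhs_ballP[r r0 rP]; exists r.
have r20 : 0 < r / 2 by rewrite divr_gt0.
pose L := @lshift n (n' + m); pose Q := @rshift n (n' + m).
pose J (j : 'I_n') := Q (lshift m j).
have LI : injective L by exact: lshift_inj.
have QI : injective Q by exact: rshift_inj.
pose T : set 'rV[R]_(n + (n' + m)) :=
  [set w : 'rV[R]_(n + (n' + m)) | [/\ forall i, 0 < (u0 0 i + r / 2) - w 0 (L i),
              forall i, 0 < w 0 (L i) - (u0 0 i - r / 2),
              forall j, w 0 (J j) = F (colsub L w) 0 j
            & S (colsub Q w)]].
exists (n' + m)%N, T; split.
- move=> p; have [Up|nUp] := pselect (ball u0 r (colsub L p)).
    have [US [USo USp USS]] := Ssa (colsub Q p).
    pose U := colsub L @^-1` ball u0 r `&` colsub Q @^-1` US.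
    exists U; split=> //.
      apply: openI; apply: open_comp ; by [move=> w _; exact: colsub_cont|exact: ball_open|].
    have A1 : semianalytic_in U (U `&`
        [set w : 'rV[R]_(n + (n' + m)) | forall i, 0 < (u0 0 i + r / 2) - w 0 (L i)]).
      apply: semianalytic_in_all => i; apply: sa_pos => a _.
      by apply: analytic_atB; [exact: analytic_at_cst|exact: analytic_at_coord].
    have A2 : semianalytic_in U (U `&`
        [set w : 'rV[R]_(n + (n' + m)) | forall i, 0 < w 0 (L i) - (u0 0 i - r / 2)]).
      apply: semianalytic_in_all => i; apply: sa_pos => a _.
      by apply: analytic_atB; [exact: analytic_at_coord|exact: analytic_at_cst].
    have A3 : semianalytic_in U (U `&`
        [set w : 'rV[R]_(n + (n' + m)) | forall j, w 0 (J j) = F (colsub L w) 0 j]).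
      apply: semianalytic_in_all => j; apply: semianalytic_in_eq => a Ua.
        exact: analytic_at_coord.
      apply: (analytic_at_colsub (g := fun u => F u 0 j)) => //.
      case: Ua => /rP[x' [cx' -> dx']] _; exact: fa.
    have A4 : semianalytic_in U (U `&` colsub Q @^-1` (US `&` S)).
      by apply: semianalytic_in_preimage USS _ => // w [].
    have := sa_setI (sa_setI A1 A2) (sa_setI A3 A4).
    congr semianalytic_in; apply/seteqP; split => w /=.
      by move=> [[[Uw h1] [_ h2]] [[_ h3] [_ [_ h4]]]].
    by move=> [Uw [h1 h2 h3 h4]]; have [_ ?] := Uw.
  have [i pi] : exists i, r <= `|u0 0 i - p 0 (L i)|.
    apply: contrapT => np; apply: nUp; split=> // k i; rewrite (ord1 k) !mxE.
    by rewrite /ball /= ltNge; apply/negP => h; apply: np; exists i.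
  exists (ball p (r / 2)); split; [exact: ball_open|exact: ballxx|].
  rewrite (_ : _ `&` _ = set0); first exact: semianalytic_in0.
  apply/seteqP; split => // w [[_ /(_ 0 (L i)) pw] [/(_ i) h1 /(_ i) h2 _ _]].
  move: pw; rewrite /ball /= ltr_norml => /andP[p1 p2].
  move: pi; rewrite leNgt => /negP h.
  by apply: h; rewrite ltr_norml; apply/andP; split; lra.
- have [M [Mr Mb]] := Sb.
  exists (`|u0| + r / 2 + `|M| + 1); split; first by rewrite num_real.
  move=> K /ltW MK w [h1 h2 _ Sw]; have u00 := normr_ge0 u0; have M0 := normr_ge0 M.
  apply: rV_norm_le; first by lra.
  move=> k; rewrite -(splitK k); case: (fintype.split k) => i /=.
    have := rV_entry_le u0 i; move: (h1 i) (h2 i); rewrite /L /= => h3 h4.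
    rewrite ler_norml => /andP[h5 h6].
    by rewrite ler_norml; apply/andP; split; lra.
  have : `|colsub Q w| <= `|M| + 1.
    by apply: Mb => //; apply: (le_lt_trans (ler_norm M)); rewrite ltrDl.
  have := rV_entry_le (colsub Q w) i; rewrite mxE /Q; lra.
- have cc := chart_fun_cont cx.
  near=> y.
  have cy : chart_dom c y.
    by near: y; apply: open_nbhs_nbhs; split => //; exact: chart_dom_open.
  have [_ by0] : ball u0 (r / 2) (c y) by near: y; apply: cc; exact: nbhsx_ballx.
  have -> : B (f y) <-> exists t, S (row_mx (d (f y)) t) by near: y; exact: fc SB.
  have EL (t : 'rV[R]_(n' + m)) : colsub L (row_mx (c y) t) = c y.
    by apply/rowP => i; rewrite mxE row_mxEl.
  have EQ (t : 'rV[R]_(n' + m)) : colsub Q (row_mx (c y) t) = t.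
    by apply/rowP => i; rewrite mxE row_mxEr.
  split=> [[t St]|[t [_ _ h3]]].
    exists (row_mx (d (f y)) t); split.
    + move=> i; have := by0 0 i; rewrite row_mxEl /ball /= ltr_norml => /andP[]; lra.
    + move=> i; have := by0 0 i; rewrite row_mxEl /ball /= ltr_norml => /andP[]; lra.
    + by move=> j; rewrite EL /F (chart_funK cy) row_mxEr row_mxEl.
    + by rewrite EQ.
  rewrite EQ => St; exists (rsubmx t).
  suff -> : d (f y) = lsubmx t by rewrite hsubmxK.
  by apply/rowP => j; have := h3 j; rewrite EL /F (chart_funK cy) row_mxEr mxE.
Unshelve. all: by end_near. Qed.

Lemma subanalytic_preimage (X Y : manifold R) (f : morphism X Y) (B : set Y) :
  subanalytic B -> subanalytic (f @^-1` B).
Proof.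
move=> Bsa x; have [d [m [S [ad dfx Ssa Sb SB]]]] := Bsa (f x).
have [c ac cx] := atlas_cover x.
have [|m' [S' [? ? ?]]] := local_projection cx dfx (@mfun_cont _ _ _ f x) _ Ssa Sb SB.
  by move=> x' ? ?; exact: mfun_analytic.
by exists c, m', S'.
Qed.

Lemma subanalyticI (X : manifold R) (A B : set X) :
  subanalytic A -> subanalytic B -> subanalytic (A `&` B).
Proof.
move=> Asa Bsa x; have [c [m1 [S1 [ac cx S1sa S1b S1A]]]] := Asa x.
have [d [m [S [ad dx Ssa Sb SB]]]] := Bsa x.
have [|m2 [S2 [S2sa S2b S2B]]] :=
  local_projection (f := @id X) cx dx (@cvg_id _ _) _ Ssa Sb SB.
  by move=> x' ? ?; exact: atlas_compat.
set n := chart_dim c in S1 S1sa S1b S1A S2 S2sa S2b S2B *.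
pose s1 (k : 'I_(n + m1)) : 'I_(n + (m1 + m2)) :=
  match fintype.split k with inl i => lshift _ i | inr j => rshift _ (lshift _ j) end.
pose s2 (k : 'I_(n + m2)) : 'I_(n + (m1 + m2)) :=
  match fintype.split k with inl i => lshift _ i | inr j => rshift _ (rshift _ j) end.
have s1I : injective s1.
  move=> k l; rewrite /s1 -{2}(splitK k) -{2}(splitK l).
  case: (fintype.split k) => i; case: (fintype.split l) => j /=.
  - by move=> /lshift_inj ->.
  - by move=> /eqP; rewrite eq_lrshift.
  - by move=> /eqP; rewrite eq_rlshift.
  - by move=> /rshift_inj/lshift_inj ->.
have s2I : injective s2.
  move=> k l; rewrite /s2 -{2}(splitK k) -{2}(splitK l).
  case: (fintype.split k) => i; case: (fintype.split l) => j /=.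
  - by move=> /lshift_inj ->.
  - by move=> /eqP; rewrite eq_lrshift.
  - by move=> /eqP; rewrite eq_rlshift.
  - by move=> /rshift_inj/rshift_inj ->.
exists c, (m1 + m2)%N, (colsub s1 @^-1` S1 `&` colsub s2 @^-1` S2); split=> //.
- move=> p; have [U1 [U1o U1p U1S]] := S1sa (colsub s1 p).
  have [U2 [U2o U2p U2S]] := S2sa (colsub s2 p).
  pose U := colsub s1 @^-1` U1 `&` colsub s2 @^-1` U2.
  exists U; split=> //.
    by apply: openI; apply: open_comp => // w _; exact: colsub_cont.
  have A1 := semianalytic_in_preimage (V := U) s1I U1S (fun w Uw => Uw.1).
  have A2 := semianalytic_in_preimage (V := U) s2I U2S (fun w Uw => Uw.2).
  have := sa_setI A1 A2; congr semianalytic_in; apply/seteqP; split => w /=.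
    by move=> [[Uw [_ h1]] [_ [_ h2]]].
  by move=> [Uw [h1 h2]]; have [? ?] := Uw.
- have [M1 [_ M1b]] := S1b; have [M2 [_ M2b]] := S2b.
  exists (`|M1| + `|M2| + 1); split; first by rewrite num_real.
  move=> K /ltW MK w [Sw1 Sw2]; have h1 := normr_ge0 M1; have h2 := normr_ge0 M2.
  have w1 : `|colsub s1 w| <= `|M1| + 1.
    by apply: M1b => //; apply: (le_lt_trans (ler_norm M1)); rewrite ltrDl.
  have w2 : `|colsub s2 w| <= `|M2| + 1.
    by apply: M2b => //; apply: (le_lt_trans (ler_norm M2)); rewrite ltrDl.
  apply: rV_norm_le; first by lra.
  have E1 k : `|w 0 (s1 k)| <= K.
    by have := rV_entry_le (colsub s1 w) k; rewrite mxE; lra.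
  have E2 k : `|w 0 (s2 k)| <= K.
    by have := rV_entry_le (colsub s2 w) k; rewrite mxE; lra.
  move=> k; rewrite -(splitK k); case: (fintype.split k) => i /=.
    by have := E1 (lshift m1 i); rewrite /s1 (unsplitK (inl i)).
  rewrite -(splitK i); case: (fintype.split i) => j /=.
    by have := E1 (rshift n j); rewrite /s1 (unsplitK (inr j)).
  by have := E2 (rshift n j); rewrite /s2 (unsplitK (inr j)).
- have E1 (u : 'rV[R]_n) (t : 'rV[R]_m1) (t' : 'rV[R]_m2) :
      colsub s1 (row_mx u (row_mx t t')) = row_mx u t.
    apply/rowP => k; rewrite mxE -{2}(splitK k) /s1.
    by case: (fintype.split k) => i /=; rewrite ?(row_mxEl, row_mxEr).
  have E2 (u : 'rV[R]_n) (t : 'rV[R]_m1) (t' : 'rV[R]_m2) :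
      colsub s2 (row_mx u (row_mx t t')) = row_mx u t'.
    apply/rowP => k; rewrite mxE -{2}(splitK k) /s2.
    by case: (fintype.split k) => i /=; rewrite ?(row_mxEl, row_mxEr).
  near=> y.
  have H1 : A y <-> exists t, S1 (row_mx (c y) t) by near: y.
  have H2 : B y <-> exists t, S2 (row_mx (c y) t) by near: y.
  split=> [[/H1[t1 T1] /H2[t2 T2]]|[t [T1 T2]]].
    by exists (row_mx t1 t2); split => /=; rewrite ?E1 ?E2.
  rewrite -(hsubmxK t) in T1 T2; split.
    by apply/H1; exists (lsubmx t); move: T1; rewrite /preimage /= E1.
  by apply/H2; exists (rsubmx t); move: T2; rewrite /preimage /= E2.
Unshelve. all: by end_near. Qed.

End SubanalyticPreimage.

Record opsa (R : realType) (X : manifold R) := OpSa {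
  osa :> set X;
  osa_open : open osa;
  osa_subanalytic : subanalytic osa }.

Definition covering (R : realType) (X : manifold R) (U : opsa X)
    (S : set (opsa X)) : Prop :=
  (forall V, S V -> V `<=` U) /\
  forall K : set X, compact K ->
    exists S0 : set (opsa X), [/\ finite_set S0, S0 `<=` S
      & K `&` \bigcup_(V in S0) osa V = K `&` U].

Definition relatively_compact (T : topologicalType) (A : set T) : Prop :=
  compact (closure A).

Record presheaf (R : realType) (k : fieldType) (X : manifold R) := Presheaf {
  sections :> opsa X -> lmodType k;
  restr : forall U V : opsa X, V `<=` U -> {linear sections U -> sections V};
  restr_id : forall (U : opsa X) (UU : U `<=` U) s, restr UU s = s;
  restr_comp : forall (U V W : opsa X) (VU : V `<=` U) (WV : W `<=` V)
    (WU : W `<=` U) s, restr WV (restr VU s) = restr WU s }.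

Arguments restr {R k X} F {U V} VU : rename.

(* Only the values of the family [s] on [S] matter.  Agreement on every member
   of the site contained in V1 and V2 is agreement on V1 `&` V2. *)
Definition matching (R : realType) (k : fieldType) (X : manifold R)
    (F : presheaf k X) (S : set (opsa X)) (s : forall V, F V) : Prop :=
  forall V1 V2 W : opsa X, S V1 -> S V2 ->
  forall (W1 : W `<=` V1) (W2 : W `<=` V2),
    restr F W1 (s V1) = restr F W2 (s V2).

Definition sheaf_axiom (R : realType) (k : fieldType) (X : manifold R)
    (F : presheaf k X) : Prop :=
  forall (U : opsa X) (S : set (opsa X)), covering U S ->
  forall s : (forall V, F V), matching S s ->
  exists! t : F U, forall (V : opsa X) (VU : V `<=` U), S V -> restr F VU t = s V.

Record sheaf (R : realType) (k : fieldType) (X : manifold R) := Sheaf {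
  sheaf_presheaf :> presheaf k X;
  sheafP : sheaf_axiom sheaf_presheaf }.

Record hom (R : realType) (k : fieldType) (X : manifold R) (F G : sheaf k X) := Hom {
  happ :> forall U, {linear F U -> G U};
  hom_natural : forall (U V : opsa X) (VU : V `<=` U) s,
    happ V (restr F VU s) = restr G VU (happ U s) }.

Definition monic (R : realType) (k : fieldType) (X : manifold R)
    (F G : sheaf k X) (u : hom F G) : Prop :=
  forall U (s : F U), u U s = 0 -> s = 0.

Definition locally_in_image (R : realType) (k : fieldType) (X : manifold R)
    (F G : sheaf k X) (u : hom F G) (U : opsa X) (t : G U) : Prop :=
  exists2 S, covering U S &
    forall (V : opsa X) (VU : V `<=` U), S V -> exists s, u V s = restr G VU t.

(* The kernel is computed sectionwise, whereas the image is the sheaf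
   associated with the sectionwise image. *)
Definition exact (R : realType) (k : fieldType) (X : manifold R)
    (F G H : sheaf k X) (u : hom F G) (v : hom G H) : Prop :=
  forall U (t : G U), v U t = 0 <-> locally_in_image u t.

Definition epic (R : realType) (k : fieldType) (X : manifold R)
    (F G : sheaf k X) (u : hom F G) : Prop :=
  forall U (t : G U), locally_in_image u t.

Definition short_exact (R : realType) (k : fieldType) (X : manifold R)
    (F' F F'' : sheaf k X) (u : hom F' F) (v : hom F F'') : Prop :=
  [/\ monic u, exact u v & epic v].

Definition hom_id (R : realType) (k : fieldType) (X : manifold R)
    (F : sheaf k X) : hom F F :=
  @Hom R k X F F (fun U => (idfun : {linear F U -> F U})) (fun _ _ _ _ => erefl).

Lemma hom_comp_natural (R : realType) (k : fieldType) (X : manifold R)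
    (F G H : sheaf k X) (v : hom G H) (u : hom F G) (U V : opsa X)
    (VU : V `<=` U) (s : F U) :
  v V (u V (restr F VU s)) = restr H VU (v U (u U s)).
Proof. by rewrite !hom_natural. Qed.

Definition hom_comp (R : realType) (k : fieldType) (X : manifold R)
    (F G H : sheaf k X) (v : hom G H) (u : hom F G) : hom F H :=
  @Hom R k X F H (fun U => (v U \o u U : {linear F U -> H U}))
    (hom_comp_natural v u).

Record functor (R : realType) (k : fieldType) (X Y : manifold R) := Functor {
  fobj :> sheaf k X -> sheaf k Y;
  fmap : forall F G : sheaf k X, hom F G -> hom (fobj F) (fobj G);
  fmap_id : forall (F : sheaf k X) U s, fmap (hom_id F) U s = s;
  fmap_comp : forall (F G H : sheaf k X) (v : hom G H) (u : hom F G) U s,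
    fmap (hom_comp v u) U s = fmap v U (fmap u U s) }.

(* J is the class of objects of a full subcategory. *)
Definition injective_wrt (R : realType) (k : fieldType) (X Y : manifold R)
    (J : sheaf k X -> Prop) (Phi : functor k X Y) : Prop :=
  [/\ forall F, exists G (u : hom F G), J G /\ monic u,
      forall F' F F'' (u : hom F' F) (v : hom F F''),
        short_exact u v -> J F' -> J F -> J F''
    & forall F' F F'' (u : hom F' F) (v : hom F F''),
        short_exact u v -> J F' -> J F -> J F'' ->
        short_exact (fmap Phi u) (fmap Phi v)].

(* Surjectivity of the restrictions between relatively compact open sets; this
   is the section form of the exactness of Hom(-, F) on R-constructible sheaves
   with compact support, the restriction Gamma(U; F) -> Gamma(V; F) being
   Hom(k_U, F) -> Hom(k_V, F). *)
Definition quasi_injective (R : realType) (k : fieldType) (X : manifold R)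
    (F : sheaf k X) : Prop :=
  forall (U V : opsa X) (VU : V `<=` U),
    relatively_compact U -> relatively_compact V ->
    forall t : F V, exists s : F U, restr F VU s = t.

Section DirectImage.
Context (R : realType) (k : fieldType) (X Y : manifold R) (f : morphism X Y).

Definition preim (V : opsa Y) : opsa X :=
  OpSa (open_comp (fun x _ => @mfun_cont _ _ _ f x) (@osa_open _ _ V))
       (@subanalytic_preimage _ _ _ f _ (@osa_subanalytic _ _ V)).

Lemma preimS (V W : opsa Y) : W `<=` V -> preim W `<=` preim V.
Proof. by move=> WV x; exact: WV. Qed.

Definition opsaI (V W : opsa Y) : opsa Y :=
  OpSa (openI (@osa_open _ _ V) (@osa_open _ _ W))
       (subanalyticI (@osa_subanalytic _ _ V) (@osa_subanalytic _ _ W)).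

Definition pushforward_presheaf (F : presheaf k X) : presheaf k Y :=
  @Presheaf R k Y (fun V => F (preim V)) (fun U V VU => restr F (preimS VU))
    (fun U UU s => restr_id (preimS UU) s)
    (fun U V W VU WV WU s =>
       restr_comp (preimS VU) (preimS WV) (preimS WU) s).

Lemma opsa_inj (U V : opsa X) : osa U = osa V -> U = V.
Proof.
case: U V => [U Uo Us] [V Vo Vs] /= UV; rewrite UV in Uo Us *.
by congr OpSa; exact: Prop_irrelevance.
Qed.

Lemma covering_preim (V : opsa Y) (S : set (opsa Y)) :
  covering V S -> covering (preim V) (preim @` S).
Proof.
move=> [SV SK]; split; first by move=> _ [W SW <-]; exact/preimS/SV.
move=> K Kc; have fK : compact (f @` K).
  apply: continuous_compact => //; apply: continuous_subspaceT.
  exact: mfun_cont.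
have [S0 [S0f S0S S0K]] := SK _ fK.
exists (preim @` S0); split; [exact: finite_image|exact: image_subset|].
apply/seteqP; split => x [Kx].
  move=> [_ [W S0W <-] Wx]; split=> //.
  suff : (f @` K `&` V) (f x) by case.
  by rewrite -S0K; split; [exists x|exists W].
move=> Vx; split=> //.
have : (f @` K `&` V) (f x) by split; first by exists x.
by rewrite -S0K => -[_ [W S0W Wx]]; exists (preim W) => //; exists W.
Qed.

Lemma pushforward_sheaf_axiom (F : sheaf k X) : sheaf_axiom (pushforward_presheaf F).
Proof.
move=> V S SV s sm; have cov := covering_preim SV.
have ext (W' : opsa X) : {t : F W' | forall W : opsa Y, S W ->
    forall h : W' `<=` preim W, preim W = W' -> t = restr F h (s W)}.
  apply: cid; have [[W [SW ->]]|nW] := pselect (exists W, S W /\ W' = preim W).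
    exists (s W) => W2 SW2 h E.
    have e : osa (preim W) = osa (preim (opsaI W W2)).
      by apply/seteqP; split => x; [move=> Wx; split => //; exact: h|case].
    have := opsa_inj e => {}e.
    have I1 : opsaI W W2 `<=` W by move=> y [].
    have I2 : opsaI W W2 `<=` W2 by move=> y [].
    have := sm W W2 (opsaI W W2) SW SW2 I1 I2; rewrite /=.
    move: (preimS I1) (preimS I2); rewrite -e => p1 p2.
    by rewrite restr_id => ->; congr (restr F _ _); exact: Prop_irrelevance.
  by exists 0 => W SW h E; case: nW; exists W.
pose t W' := sval (ext W').
have tE W : S W -> t (preim W) = s W.
  move=> SW; rewrite /t; case: (ext (preim W)) => /= x /(_ W SW (fun _ => id) erefl) ->.
  exact: restr_id.
have tm : matching (preim @` S) t.
  move=> _ _ W' [V1 SV1 <-] [V2 SV2 <-] W1 W2; rewrite !tE //.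
  have I1 : opsaI V1 V2 `<=` V1 by move=> y [].
  have I2 : opsaI V1 V2 `<=` V2 by move=> y [].
  have h : W' `<=` preim (opsaI V1 V2) by move=> x W'x; split; [exact: W1|exact: W2].
  have := sm V1 V2 _ SV1 SV2 I1 I2.
  by move=> /(congr1 (restr F h)); rewrite /= !(restr_comp _ _ W1) !(restr_comp _ _ W2).
have [g [gP gU]] := sheafP cov tm.
exists g; split.
  by move=> W WV SW; rewrite -tE //; apply: gP; exists W.
move=> g' g'P; apply: gU => V0 WV [W SW WE]; case: _ / WE in WV *.
have WV' : W `<=` V by case: SV => + _; exact.
transitivity (s W); last by rewrite tE.
by rewrite -(g'P W WV' SW) /=; congr (restr F _ _); exact: Prop_irrelevance.
Qed.

Definition pushforward (F : sheaf k X) : sheaf k Y :=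
  Sheaf (@pushforward_sheaf_axiom F).

Definition pushforward_hom (F G : sheaf k X) (u : hom F G) :
    hom (pushforward F) (pushforward G) :=
  @Hom R k Y (pushforward F) (pushforward G) (fun V => u (preim V))
    (fun U V VU => hom_natural u (preimS VU)).

Definition direct_image : functor k X Y :=
  @Functor R k X Y pushforward pushforward_hom
    (fun _ _ _ => erefl) (fun _ _ _ _ _ _ _ => erefl).

End DirectImage.

(* Main.v *)
Require Import Defs.
From HB Require Import structures.
From mathcomp Require Import all_boot all_order all_algebra.
From mathcomp Require Import all_classical all_reals all_analysis.
From mathcomp Require Import lra generic_quotient ring_quotient.
Import Defs.
Set Implicit Arguments.
Unset Strict Implicit.
Unset Printing Implicit Defensive.
Import Order.TTheory GRing.Theory Num.Theory numFieldNormedType.Exports.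
Local Open Scope classical_set_scope.
Local Open Scope ring_scope.

(** The manifold X is the union of an increasing sequence E_n of relatively
    compact open subanalytic sets such that every compact set lies in some E_n
    ([exhaustion]); hence a section over any U of the site is a compatible
    sequence of sections over the relatively compact sets U `&` E_n.  Everything
    about direct images follows from this, because the preimage under f of a
    relatively compact set need not be relatively compact: properties that
    quasi-injectivity gives over relatively compact sets have to be carried to
    arbitrary members of the site, by building sections along E_n one step at a
    time.

    In this way a quasi-injective sheaf has surjective restrictions between
    arbitrary members of the site ([quasi_injective_flabby]), so that its direct
    image is quasi-injective.

    Let 0 -> F' -> F -> F'' -> 0 be exact with F' quasi-injective.  A section t of
    F'' lifts locally to F.  Two lifts over A and B differ over A `&` B by a
    section of F'; extending that section to B and adding it to the lift over B
    makes the two lifts agree, so that they glue ([lift_pair]).  Over a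
    relatively compact set a finite cover suffices, and induction lifts t
    ([lift_relatively_compact]); along E_n the same correction makes successive
    lifts compatible, and t lifts over any U ([lift_global]).  The first result
    shows that F'' is quasi-injective when F is, the second one that f_* keeps the
    sequence exact.

    It remains to embed a sheaf F in a quasi-injective one.  Points of X do not
    suffice to detect sections on the subanalytic site; ultrafilters on the set X
    containing a relatively compact member of the site do.  Let the Godement
    sheaf have as sections over U the families of germs indexed by such
    ultrafilters containing U.  Its restriction maps drop factors of a product,
    so they are surjective.  The map from F is a monomorphism because, for a
    nonzero section s over a relatively compact U, the sets U `\` V with s zero
    on V generate a proper filter, which an ultrafilter refines: the germ of s
    there is not zero ([separating_point]). *)

(** * Subanalytic sets: unions and coordinate cubes *)

Section SubanalyticUnion.
Context {R : realType}.

Lemma semianalyticU n (A B : set 'rV[R]_n) :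
  semianalytic A -> semianalytic B -> semianalytic (A `|` B).
Proof.
move=> Asa Bsa p; have [U1 [U1o U1p A1]] := Asa p.
have [U2 [U2o U2p B2]] := Bsa p.
exists (U1 `&` U2); split; [exact: openI|by []|].
have A' := semianalytic_inW A1 (@subIsetl _ U1 U2).
have B' := semianalytic_inW B2 (@subIsetr _ U1 U2).
have := sa_diff (sa_setI (sa_diff A') (sa_diff B')).
congr semianalytic_in; apply/seteqP; split => x /=.
  move=> [[Ux1 Ux2] h]; split => //.
  have [Ax|nAx] := pselect (A x); first by left.
  have [Bx|nBx] := pselect (B x); first by right.
  by case: h; split; split => // -[_] [].
move=> [[Ux1 Ux2] AB]; split => // -[[_ nA] [_ nB]].
by case: AB => [Ax|Bx]; [apply: nA|apply: nB].
Qed.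

(** The graph of the zero map over S: a set with the same projections as S, in
    more variables. *)
Definition zero_ext n N (s : 'I_n -> 'I_N) (S : set 'rV[R]_n) : set 'rV[R]_N :=
  [set w | S (colsub s w) /\ forall j, j \notin codom s -> w 0 j = 0].

Lemma semianalytic_zero_ext n N (s : 'I_n -> 'I_N) (S : set 'rV[R]_n) :
  injective s -> semianalytic S -> semianalytic (zero_ext s S).
Proof.
move=> sI Ssa p; have [U0 [U0o U0p US]] := Ssa (colsub s p).
exists (colsub s @^-1` U0); split => //.
  by apply: open_comp => // w _; exact: colsub_cont.
set U := _ @^-1` U0.
have A1 := semianalytic_in_preimage (V := U) sI US (fun w Uw => Uw).
have A2 : semianalytic_in U
    (U `&` [set w | forall j, j \notin codom s -> w 0 j = 0]).
  apply: semianalytic_in_all => j; case: (boolP (j \in codom s)) => js.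
    rewrite (_ : _ `&` _ = U); first exact: semianalytic_inT.
    by apply/seteqP; split => [w []|].
  rewrite (_ : _ `&` _ = U `&` [set w | w 0 j = 0]).
    apply: semianalytic_in_eq => a _; first exact: analytic_at_coord.
    exact: analytic_at_cst.
  by apply/seteqP; split => [w [Uw h]|w [Uw h]]; split => //; exact: h.
have := sa_setI A1 A2; congr semianalytic_in; apply/seteqP; split => w /=.
  by move=> [[Uw [_ h1]] [_ h2]].
by move=> [Uw [h1 h2]].
Qed.

Lemma bounded_zero_ext n N (s : 'I_n -> 'I_N) (S : set 'rV[R]_n) :
  bounded_set S -> bounded_set (zero_ext s S).
Proof.
move=> [M [_ Mb]]; exists (`|M| + 1); split; first by rewrite num_real.
move=> K /ltW MK w [Sw w0]; have h1 := normr_ge0 M.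
have ws : `|colsub s w| <= `|M| + 1.
  by apply: Mb => //; apply: (le_lt_trans (ler_norm M)); rewrite ltrDl.
apply: rV_norm_le => [|j]; first by lra.
have [/codomP[i ->]|js] := boolP (j \in codom s); last by rewrite w0 // normr0; lra.
by have := rV_entry_le (colsub s w) i; rewrite mxE; lra.
Qed.

Lemma bounded_setU n (A B : set 'rV[R]_n) :
  bounded_set A -> bounded_set B -> bounded_set (A `|` B).
Proof.
move=> [M1 [M1r M1b]] [M2 [M2r M2b]]; exists (Num.max M1 M2); split.
  by rewrite num_real.
by move=> K; rewrite gt_max => /andP[K1 K2] x [/M1b|/M2b]; exact.
Qed.

(** Near a point, both sets are projections in one chart, of sets S1 and S2 with
    m1 and m2 auxiliary variables.  Their union is the projection of a union in
    m1 + m2 auxiliary variables, in which the superfluous ones are set to zero to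
    keep the set bounded. *)
Lemma subanalyticU (X : manifold R) (A B : set X) :
  subanalytic A -> subanalytic B -> subanalytic (A `|` B).
Proof.
move=> Asa Bsa x; have [c [m1 [S1 [ac cx S1sa S1b S1A]]]] := Asa x.
have [d [m [S [ad dx Ssa Sb SB]]]] := Bsa x.
have [|m2 [S2 [S2sa S2b S2B]]] :=
  local_projection (f := @id X) cx dx (@cvg_id _ _) _ Ssa Sb SB.
  by move=> x' ? ?; exact: atlas_compat.
set n := chart_dim c in S1 S1sa S1b S1A S2 S2sa S2b S2B *.
pose s1 (k : 'I_(n + m1)) : 'I_(n + (m1 + m2)) :=
  match fintype.split k with inl i => lshift _ i | inr j => rshift _ (lshift _ j) end.
pose s2 (k : 'I_(n + m2)) : 'I_(n + (m1 + m2)) :=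
  match fintype.split k with inl i => lshift _ i | inr j => rshift _ (rshift _ j) end.
have s1l i : s1 (lshift _ i) = lshift _ i by rewrite /s1 (unsplitK (inl i)).
have s1r j : s1 (rshift _ j) = rshift _ (lshift _ j).
  by rewrite /s1 (unsplitK (inr j)).
have s2l i : s2 (lshift _ i) = lshift _ i by rewrite /s2 (unsplitK (inl i)).
have s2r j : s2 (rshift _ j) = rshift _ (rshift _ j).
  by rewrite /s2 (unsplitK (inr j)).
have s1I : injective s1.
  move=> k l; rewrite -(splitK k) -(splitK l).
  case: (fintype.split k) => i; case: (fintype.split l) => j /=;
    rewrite ?s1l ?s1r.
  - by move=> /lshift_inj ->.
  - by move=> /eqP; rewrite eq_lrshift.
  - by move=> /eqP; rewrite eq_rlshift.
  - by move=> /rshift_inj/lshift_inj ->.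
have s2I : injective s2.
  move=> k l; rewrite -(splitK k) -(splitK l).
  case: (fintype.split k) => i; case: (fintype.split l) => j /=;
    rewrite ?s2l ?s2r.
  - by move=> /lshift_inj ->.
  - by move=> /eqP; rewrite eq_lrshift.
  - by move=> /eqP; rewrite eq_rlshift.
  - by move=> /rshift_inj/rshift_inj ->.
exists c, (m1 + m2)%N, (zero_ext s1 S1 `|` zero_ext s2 S2); split=> //.
- by apply: semianalyticU; exact: semianalytic_zero_ext.
- by apply: bounded_setU; exact: bounded_zero_ext.
- have E1 (u : 'rV[R]_n) (t : 'rV[R]_(m1 + m2)) :
      colsub s1 (row_mx u t) = row_mx u (lsubmx t).
    apply/rowP => k; rewrite mxE -(splitK k).
    by case: (fintype.split k) => i /=; rewrite ?s1l ?s1r ?row_mxEl ?row_mxEr ?mxE.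
  have E2 (u : 'rV[R]_n) (t : 'rV[R]_(m1 + m2)) :
      colsub s2 (row_mx u t) = row_mx u (rsubmx t).
    apply/rowP => k; rewrite mxE -(splitK k).
    by case: (fintype.split k) => i /=; rewrite ?s2l ?s2r ?row_mxEl ?row_mxEr ?mxE.
  near=> y.
  have H1 : A y <-> exists t, S1 (row_mx (c y) t) by near: y.
  have H2 : B y <-> exists t, S2 (row_mx (c y) t) by near: y.
  split=> [[/H1[t T]|/H2[t T]]|[t [[T _]|[T _]]]].
  + exists (row_mx t 0); left; split; first by rewrite E1 row_mxKl.
    move=> j; rewrite -(splitK j); case: (fintype.split j) => i /=.
      by rewrite -s1l codom_f.
    rewrite -(splitK i) row_mxEr; case: (fintype.split i) => i' /=.
      by rewrite -s1r codom_f.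
    by rewrite row_mxEr mxE.
  + exists (row_mx 0 t); right; split; first by rewrite E2 row_mxKr.
    move=> j; rewrite -(splitK j); case: (fintype.split j) => i /=.
      by rewrite -s2l codom_f.
    rewrite -(splitK i) row_mxEr; case: (fintype.split i) => i' /=.
      by rewrite row_mxEl mxE.
    by rewrite -s2r codom_f.
  + by left; apply/H1; exists (lsubmx t); rewrite -E1.
  + by right; apply/H2; exists (rsubmx t); rewrite -E2.
Unshelve. all: by end_near. Qed.

(** What subanalyticity asks for at a point outside the closure of A. *)
Lemma subanalytic_near0 (X : manifold R) (A : set X) (x : X) c :
  atlas c -> chart_dom c x -> (\forall y \near x, ~ A y) ->
  exists (c : chart R X) (m : nat) (S : set 'rV[R]_(chart_dim c + m)),
    [/\ atlas c, chart_dom c x, semianalytic S, bounded_set S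
      & \forall y \near x, A y <-> exists t, S (row_mx (c y) t)].
Proof.
move=> ac cx nA; exists c, 0%N, set0; split => //.
- by move=> p; exists setT; split;
    [exact: openT|by []|rewrite setI0; exact: semianalytic_in0].
- by exists 0; split => [|? ? ? //]; rewrite num_real.
- by apply: filterS nA => y nAy; split => // -[].
Qed.

Lemma subanalytic0 (X : manifold R) : subanalytic (@set0 X).
Proof.
move=> x; have [c ac cx] := atlas_cover x.
by apply: (subanalytic_near0 ac cx); apply: filterE => y [].
Qed.

Definition cube n (a : 'rV[R]_n) (r : R) : set 'rV[R]_n :=
  [set w | forall i, `|w 0 i - a 0 i| < r].

(** The norm of row vectors is the sup norm, so cubes are balls; as cubes they are
    visibly semianalytic. *)
Lemma cubeE n (a : 'rV[R]_n) r : 0 < r -> cube a r = ball a r.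
Proof.
move=> r0; apply/seteqP; split => w.
  by move=> h; split=> // i j; rewrite (ord1 i) /ball /= distrC; exact: h.
by move=> [_ h] i; have := h 0 i; rewrite /ball /= distrC.
Qed.

Definition chart_cube (X : manifold R) (c : chart R X) a r : set X :=
  chart_dom c `&` c @^-1` cube a r.

(** The chart domain is only known to be open in X, so control near its boundary
    comes from the closed box K: its image under the inverse chart is compact,
    hence closed in X, and contains the closure of the cube. *)
Section ChartCube.
Variables (X : manifold R) (c : chart R X) (a : 'rV[R]_(chart_dim c)) (r : R).
Hypotheses (ac : atlas c) (r0 : 0 < r).
Let K : set 'rV[R]_(chart_dim c) := [set w | forall i, `|w 0 i - a 0 i| <= r].
Hypothesis Kdom : K `<=` c @` chart_dom c.

Lemma chart_cube_open : open (chart_cube a r).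
Proof.
rewrite openE => y [dy cy]; rewrite /interior; near=> z; split.
  by near: z; apply: open_nbhs_nbhs; split => //; exact: chart_dom_open.
rewrite /preimage /=; near: z; apply: (chart_fun_cont dy).
by rewrite cubeE // in cy *; apply: open_nbhs_nbhs; split => //; exact: ball_open.
Unshelve. all: by end_near. Qed.

Lemma compact_box : compact K.
Proof.
have -> : K = [set v | forall i, `[a 0 i - r, a 0 i + r]%classic (v ord0 i)].
  apply/seteqP; split => v h i; have := h i; rewrite /= in_itv /=.
    by rewrite ler_norml => /andP[? ?]; apply/andP; split; lra.
  by move=> /andP[? ?]; rewrite ler_norml; apply/andP; split; lra.
apply: (@rV_compact _  _ (fun i => `[a 0 i - r, a 0 i + r]%classic)).
by move=> i; exact: segment_compact.
Qed.

Lemma chart_cube_closure : compact (chart_inv c @` K) /\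
  closure (chart_cube a r) `<=` chart_inv c @` K.
Proof.
have cK : compact (chart_inv c @` K).
  apply: continuous_compact; last exact: compact_box.
  apply: continuous_in_subspaceT => u /set_mem /Kdom[x dx <-].
  rewrite /continuous_at chart_funK //; exact: chart_inv_cont.
split=> //; have /closure_id -> := compact_closed (@manifold_hausdorff _ X) cK.
apply: closure_subset => y [dy cy]; exists (c y); last exact: chart_funK.
by move=> i; apply: ltW; exact: cy.
Qed.

Lemma chart_cube_relatively_compact : relatively_compact (chart_cube a r).
Proof.
have [cK sK] := chart_cube_closure.
by apply: subclosed_compact cK sK; exact: closed_closure.
Qed.

Lemma chart_cube_subanalytic : subanalytic (chart_cube a r).
Proof.
move=> x; have [dx|ndx] := pselect (chart_dom c x).
  pose lo := [set w : 'rV[R]_(chart_dim c + 0) |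
    forall i, 0 < w 0 (lshift 0 i) - (a 0 i - r)].
  pose hi := [set w : 'rV[R]_(chart_dim c + 0) |
    forall i, 0 < (a 0 i + r) - w 0 (lshift 0 i)].
  have SE w : cube a r (colsub (lshift 0) w) <-> (lo `&` hi) w.
    split => [h|[h1 h2] i].
      by split => i; have := h i; rewrite mxE ltr_norml => /andP[]; lra.
    by have := h1 i; have := h2 i; rewrite mxE ltr_norml => ? ?; apply/andP; split; lra.
  exists c, 0%N, (lo `&` hi); split => //.
  - move=> p; exists setT; split => //; first exact: openT.
    rewrite -[setT in X in semianalytic_in _ X]setIid setIACA; apply: sa_setI;
      apply: semianalytic_in_all => i; apply: sa_pos => b _; apply: analytic_atB;
      by [exact: analytic_at_cst|exact: analytic_at_coord|
          apply: analytic_atB; [exact: analytic_at_coord|exact: analytic_at_cst]].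
  - exists (`|a| + r); split; first by rewrite num_real.
    move=> M /ltW aM w /SE h; have a0 := normr_ge0 a.
    apply: rV_norm_le => [|k]; first by rewrite (le_trans _ aM) // addr_ge0 // ltW.
    rewrite -(splitK k); case: (fintype.split k) => [i|[]//] /=.
    have := h i; rewrite mxE => h'; have := rV_entry_le a i.
    by have := ler_normD (w 0 (lshift 0 i) - a 0 i) (a 0 i); rewrite subrK; lra.
  - near=> y.
    have dy : chart_dom c y.
      by near: y; apply: open_nbhs_nbhs; split => //; exact: chart_dom_open.
    have E (t : 'rV[R]_0) : colsub (lshift 0) (row_mx (c y) t) = c y.
      by apply/rowP => i; rewrite mxE row_mxEl.
    by split=> [[_ cy]|[t /SE]]; [exists 0; apply/SE|]; rewrite E.
have [d ad dx] := atlas_cover x; apply: (subanalytic_near0 ad dx).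
have [cK sK] := chart_cube_closure.
have cl := compact_closed (@manifold_hausdorff _ X) cK.
have : (~` (chart_inv c @` K)) x.
  by move=> [u /Kdom[y dy <-]]; rewrite chart_funK // => yx; apply: ndx; rewrite -yx.
move=> nKx; have : nbhs x (~` (chart_inv c @` K)).
  by apply: open_nbhs_nbhs; split => //; exact: closed_openC.
by apply: filterS => y nK Ay; apply: nK; apply: sK; exact: subset_closure.
Unshelve. all: by end_near. Qed.

End ChartCube.
End SubanalyticUnion.

(** * Exhaustion by relatively compact subanalytic open sets *)

Lemma relatively_compactS (T : topologicalType) (A B : set T) :
  A `<=` B -> relatively_compact B -> relatively_compact A.
Proof.
by move=> AB Bc; apply: subclosed_compact Bc (closure_subset AB); exact: closed_closure.
Qed.

Lemma relatively_compactU (T : topologicalType) (A B : set T) :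
  relatively_compact A -> relatively_compact B -> relatively_compact (A `|` B).
Proof. by rewrite /relatively_compact closureU; exact: compactU. Qed.

Section Exhaustion.
Context {R : realType} (X : manifold R).

Definition opsa0 : opsa X := OpSa open0 (@subanalytic0 R X).

Definition opsaU (U V : opsa X) : opsa X :=
  OpSa (openU (@osa_open _ _ U) (@osa_open _ _ V))
       (subanalyticU (@osa_subanalytic _ _ U) (@osa_subanalytic _ _ V)).

Lemma relatively_compact_nbhd (x : X) :
  exists2 W : opsa X, osa W x & relatively_compact W.
Proof.
have [c ac cx] := atlas_cover x.
have : nbhs (c x) (c @` chart_dom c).
  by apply: open_nbhs_nbhs; split; [exact: chart_img_open|exists x].
move=> /nbhs_ballP[e /= e0 eP].
have r0 : 0 < e / 2 by rewrite divr_gt0.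
have Kdom : [set w : 'rV[R]_(chart_dim c) |
    forall i, `|w 0 i - c x 0 i| <= e / 2] `<=` c @` chart_dom c.
  move=> w h; apply: eP; rewrite -cubeE // => i.
  by apply: le_lt_trans (h i) _; rewrite ltr_pdivrMr // ltr_pMr // ltr1n.
exists (OpSa (chart_cube_open (c x) r0) (chart_cube_subanalytic ac r0 Kdom)).
  by split => //= i; rewrite subrr normr0.
exact: (chart_cube_relatively_compact Kdom).
Qed.

(** Choose a countable basis and, for each member contained in some relatively
    compact element of the site, one such element; E_n is the union of the first
    n + 1 choices. *)
Lemma exhaustion : exists E : nat -> opsa X,
  [/\ forall n, E n `<=` E n.+1, forall n, relatively_compact (E n)
    & forall K, compact K -> exists n, K `<=` E n].
Proof.
have [B /countable_injP[g gI] [Bo Bb]] := manifold_countable X.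
pose good (b : set X) (W : opsa X) := relatively_compact W /\ b `<=` W.
have /choice[W WP] i : exists W : opsa X, relatively_compact W /\
    forall b, B b -> g b = i -> (exists W', good b W') -> b `<=` W.
  have [[b [Bb' gb [W' [W'c bW']]]]|nb] :=
      pselect (exists b, [/\ B b, g b = i & exists W', good b W']).
    exists W'; split => // b1 Bb1 gb1 _.
    by have -> : b1 = b by apply: gI; rewrite ?inE // gb.
  exists opsa0; split; first by rewrite /relatively_compact closure0; exact: compact0.
  by move=> b Bb' gb h; case: nb; exists b.
pose E := fix E n := if n is m.+1 then opsaU (E m) (W n) else W 0%N.
have ES n : E n `<=` E n.+1 by move=> x; left.
have Em n m : (n <= m)%N -> E n `<=` E m.
  elim: m => [|m IH]; first by rewrite leqn0 => /eqP ->.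
  by rewrite leq_eqVlt ltnS => /predU1P[-> //|/IH h]; apply: subset_trans h (ES m).
have WE n : W n `<=` E n by case: n => [|n] //= x; right.
exists E; split => //.
  elim=> [|n IH] /=; first exact: (WP 0%N).1.
  by apply: relatively_compactU => //; exact: (WP n.+1).1.
move=> K /compact_near_coveringP/(_ nat \oo (fun n x => osa (E n) x)) h.
have [|N _ NP] := h _; last by exists N; apply: NP => /=.
move=> x Kx; have [W' W'x W'c] := relatively_compact_nbhd x.
have /Bb[b [Bb' bx] bW'] : nbhs x W'.
  by apply: open_nbhs_nbhs; split => //; exact: osa_open.
have bW : b `<=` W (g b) by apply: (WP (g b)).2 => //; exists W'.
exists (b, [set n | (g b <= n)%N]); first split.
- by apply: open_nbhs_nbhs; split => //; exact: Bo.
- by exists (g b).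
- by move=> [y n] /= [yb gn]; apply: (Em _ _ gn); apply: WE; apply: bW.
Qed.

End Exhaustion.

(** * Coverings and gluing *)

Lemma finite_set_ind (T : Type) (P : set T -> Prop) :
  P set0 -> (forall x A, P A -> P (x |` A)) -> forall A, finite_set A -> P A.
Proof.
move=> P0 PS A /(@finite_seqP {classic T})[s ->].
elim: s => [|x s IH]; first by rewrite set_nil.
rewrite (_ : [set` _] = x |` [set` s]); first exact: PS.
by apply/seteqP; split => y /=; rewrite inE; [move/predU1P|move=> h; apply/predU1P].
Qed.

Section Coverings.
Context {R : realType} {X : manifold R}.

Lemma covering_self (U : opsa X) : covering U [set U].
Proof.
split=> [_ -> //|K _]; exists [set U]; split => //.
by rewrite bigcup_set1.
Qed.

Lemma covering0 : covering (opsa0 X) set0.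
Proof.
split=> // K _; exists set0; split => //.
by rewrite bigcup_set0 setI0.
Qed.

Lemma covering_pair (U V : opsa X) :
  covering (opsaU U V) (range (fun b : bool => if b then U else V)).
Proof.
split=> [_ [[] _ <-] x|K _]; [by left|by right|].
exists (range (fun b : bool => if b then U else V)); split => //.
  by apply: finite_image; exact: finite_finset.
congr (_ `&` _); rewrite bigcup_image; apply/seteqP; split => x.
  by move=> [[] _ ?]; [left|right].
by move=> [?|?]; [exists true|exists false].
Qed.

Lemma covering_exhaustion (E : nat -> opsa X) (U : opsa X) :
  (forall K, compact K -> exists n, K `<=` E n) ->
  covering U (range (fun n => opsaI U (E n))).
Proof.
move=> EK; split=> [_ [n _ <-] x []//|K /EK[n KE]].
exists [set opsaI U (E n)]; split; [exact: finite_set1|by move=> _ ->; exists n|].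
rewrite bigcup_set1 /=; apply/seteqP; split => x; first by move=> [Kx []].
by move=> [Kx Ux]; split => //; split => //; exact: KE.
Qed.

End Coverings.

Section Gluing.
Context {R : realType} {k : fieldType} {X : manifold R}.

Lemma restr_irr (F : presheaf k X) (U V : opsa X) (h h' : V `<=` U) s :
  restr F h s = restr F h' s.
Proof. by congr (restr F _ s); exact: Prop_irrelevance. Qed.

Lemma sheaf_separated (F : sheaf k X) (U : opsa X) S (t t' : F U) :
  covering U S ->
  (forall (V : opsa X) (h : V `<=` U), S V -> restr F h t = restr F h t') -> t = t'.
Proof.
move=> cov tt'; have [SU _] := cov.
pose s V : F V := if pselect (V `<=` U) is left h then restr F h t else 0.
have sE (V : opsa X) (h : V `<=` U) : s V = restr F h t.
  by rewrite /s; case: pselect => // h'; exact: restr_irr.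
have sm : matching S s.
  move=> V1 V2 W SV1 SV2 W1 W2; rewrite (sE _ (SU _ SV1)) (sE _ (SU _ SV2)).
  have WU : W `<=` U by apply: subset_trans W1 (SU _ SV1).
  by rewrite !(restr_comp _ _ WU).
have [g [_ gU]] := sheafP cov sm.
rewrite -(gU t) => [|V h SV]; last by rewrite -sE.
by apply: gU => V h SV; rewrite -tt' // -sE.
Qed.

(** The sheaf axiom speaks of families indexed by the site itself; here the
    covering is indexed by a type I, which avoids transporting sections along
    equalities of members of the site. *)
Lemma sheaf_glue (F : sheaf k X) I (A : I -> opsa X) (U : opsa X)
    (s : forall i, F (A i)) :
  covering U (range A) ->
  (forall i j (W : opsa X) (Wi : W `<=` A i) (Wj : W `<=` A j),
    restr F Wi (s i) = restr F Wj (s j)) ->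
  exists t : F U, forall i (h : A i `<=` U), restr F h t = s i.
Proof.
move=> cov sc.
(* The two inclusions state that V is A i without an equation between types. *)
have ext (V : opsa X) : {x : F V |
    forall i (h : V `<=` A i), (A i `<=` V) -> x = restr F h (s i)}.
  apply: cid; have [[i [h _]]|nV] :=
      pselect (exists i (h : V `<=` A i), A i `<=` V).
    by exists (restr F h (s i)) => j hj _; exact: sc.
  by exists 0 => i h h'; case: nV; exists i, h.
pose r V := sval (ext V).
have rE i : r (A i) = s i.
  by rewrite /r (svalP (ext (A i)) i (fun=> id) (fun=> id)) restr_id.
have rm : matching (range A) r.
  by move=> _ _ W [i _ <-] [j _ <-] Wi Wj; rewrite !rE.
have [t [tP _]] := sheafP cov rm.
by exists t => i h; rewrite tP ?rE //; exists i.
Qed.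

Lemma sheaf_glue_pair (F : sheaf k X) (A B : opsa X) (a : F A) (b : F B) :
  (forall (hA : opsaI A B `<=` A) (hB : opsaI A B `<=` B),
    restr F hA a = restr F hB b) ->
  exists t : F (opsaU A B),
    (forall h : A `<=` opsaU A B, restr F h t = a) /\
    (forall h : B `<=` opsaU A B, restr F h t = b).
Proof.
move=> ab.
pose C (i : bool) := if i then A else B.
pose s i : F (C i) := if i is true then a else b.
have IA : opsaI A B `<=` A by move=> x [].
have IB : opsaI A B `<=` B by move=> x [].
have sc i j (W : opsa X) (Wi : W `<=` C i) (Wj : W `<=` C j) :
    restr F Wi (s i) = restr F Wj (s j).
  have E (WA : W `<=` A) (WB : W `<=` B) : restr F WA a = restr F WB b.
    have h : W `<=` opsaI A B by move=> x Wx; split; [exact: WA|exact: WB].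
    by rewrite -(restr_comp IA h) (ab IA IB) restr_comp.
  by case: i j Wi Wj => [] []; rewrite /C /s => Wi Wj;
    rewrite ?(E Wi Wj) ?(E Wj Wi) //; exact: restr_irr.
have [t tP] := sheaf_glue (covering_pair A B) sc.
by exists t; split => h; [exact: (tP true)|exact: (tP false)].
Qed.

Lemma sheaf_glue_exhaustion (F : sheaf k X) (E : nat -> opsa X) (U : opsa X)
    (s : forall n, F (opsaI U (E n))) :
  (forall n, E n `<=` E n.+1) ->
  (forall K, compact K -> exists n, K `<=` E n) ->
  (forall n (h : opsaI U (E n) `<=` opsaI U (E n.+1)), restr F h (s n.+1) = s n) ->
  exists t : F U, forall n (h : opsaI U (E n) `<=` U), restr F h t = s n.
Proof.
move=> ES EK sS.
have EE n m : (n <= m)%N -> E n `<=` E m.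
  elim: m => [|m IH]; first by rewrite leqn0 => /eqP ->.
  by rewrite leq_eqVlt ltnS => /predU1P[-> //|/IH h]; apply: subset_trans h (ES m).
have UE n m : (n <= m)%N -> opsaI U (E n) `<=` opsaI U (E m).
  by move=> nm x [Ux Ex]; split => //; exact: EE Ex.
have sE n m (nm : (n <= m)%N) (h : opsaI U (E n) `<=` opsaI U (E m)) :
    restr F h (s m) = s n.
  elim: m nm h => [|m IH] nm h.
    by move: nm h; rewrite leqn0 => /eqP -> h; rewrite restr_id.
  move: nm; rewrite leq_eqVlt ltnS => /predU1P[nm|nm].
    by rewrite -nm in h *; rewrite restr_id.
  by rewrite -(IH nm (UE _ _ nm)) -(sS m (UE _ _ (leqnSn m))) restr_comp.
apply: sheaf_glue (covering_exhaustion U EK) _.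
suff H i j (W : opsa X) (Wi : W `<=` opsaI U (E i)) (Wj : W `<=` opsaI U (E j)) :
    (i <= j)%N -> restr F Wi (s i) = restr F Wj (s j).
  move=> i j W Wi Wj; have [ij|/ltnW ij] := leqP i j; first exact: H.
  by rewrite (H _ _ _ Wj Wi).
by move=> ij; rewrite -(sE _ _ ij (UE _ _ ij)) restr_comp.
Qed.

Lemma sheaf_opsa0 (F : sheaf k X) (t t' : F (opsa0 X)) : t = t'.
Proof. exact: sheaf_separated covering0 _. Qed.

End Gluing.

(** * Extension and lifting of sections *)

Lemma dep_dependent_choice (T : nat -> Type) (P : forall n, T n -> T n.+1 -> Prop)
    (x0 : T 0%N) :
  (forall n x, exists y, @P n x y) ->
  exists f : forall n, T n, forall n, P n (f n) (f n.+1).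
Proof.
move=> h; pose step n x := cid (h n x).
by exists (nat_rect T x0 (fun n x => sval (step n x))) => n; exact: svalP (step n _).
Qed.

Section Lifting.
Context {R : realType} {k : fieldType} {X : manifold R}.

Lemma quasi_injective_extend (F : sheaf k X) (U V : opsa X) (VU : V `<=` U) :
  quasi_injective F -> relatively_compact U ->
  forall t : F V, exists s : F U, restr F VU s = t.
Proof. by move=> qF Uc; apply: qF => //; exact: relatively_compactS VU Uc. Qed.

(** The extension of t is built over U `&` E_n by induction: the extension
    obtained over U `&` E_n and the restriction of t to V `&` E_n.+1 agree on
    their common domain V `&` E_n, and the section glued from them extends to
    U `&` E_n.+1 by quasi-injectivity. *)
Lemma quasi_injective_flabby (F : sheaf k X) (U V : opsa X) (VU : V `<=` U) :
  quasi_injective F -> forall t : F V, exists s : F U, restr F VU s = t.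
Proof.
move=> qF t; have [E [ES Ec EK]] := exhaustion X.
have IVU n : opsaI V (E n) `<=` opsaI U (E n).
  by move=> x [Vx Ex]; split => //; exact: VU.
have IV n : opsaI V (E n) `<=` V by move=> x [].
have IU n : opsaI U (E n) `<=` U by move=> x [].
have Ic n : relatively_compact (opsaI U (E n)).
  by apply: relatively_compactS (Ec n) => x [].
pose T n := {s : F (opsaI U (E n)) | restr F (IVU n) s = restr F (IV n) t}.
have [s00 s00P] := quasi_injective_extend (IVU 0%N) qF (Ic 0%N) (restr F (IV 0%N) t).
have step n (x : T n) : exists y : T n.+1,
    forall h, restr F h (sval y) = sval x :> F (opsaI U (E n)).
  case: x => x xP /=; set A := opsaI U (E n) in x xP *.
  have [z [zA zV]] : exists z : F (opsaU A (opsaI V (E n.+1))),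
      (forall h, restr F h z = x) /\ (forall h, restr F h z = restr F (IV n.+1) t).
    apply: sheaf_glue_pair => hA hB.
    have h : opsaI A (opsaI V (E n.+1)) `<=` opsaI V (E n).
      by move=> y [[? ?] [? ?]].
    have hV : opsaI A (opsaI V (E n.+1)) `<=` V by move=> y [_ []].
    by rewrite -(restr_comp (IVU n) h hA) xP !(restr_comp _ _ hV).
  have AU : opsaU A (opsaI V (E n.+1)) `<=` opsaI U (E n.+1).
    by move=> y [[Uy Ey]|[Vy Ey]]; split => //; [exact: ES|exact: VU].
  have [y yP] := quasi_injective_extend AU qF (Ic n.+1) z.
  have hA : A `<=` opsaU A (opsaI V (E n.+1)) by move=> w; left.
  have hV : opsaI V (E n.+1) `<=` opsaU A (opsaI V (E n.+1)) by move=> w; right.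
  have yV : restr F (IVU n.+1) y = restr F (IV n.+1) t.
    by rewrite -(restr_comp AU hV) yP zV.
  by exists (exist _ y yV) => h /=; rewrite -(restr_comp AU hA) yP zA.
have [s sP] := dep_dependent_choice (exist _ s00 s00P : T 0%N) step.
have [g gP] := sheaf_glue_exhaustion ES EK sP.
exists g; apply: sheaf_separated (covering_exhaustion V EK) _ => W h [n _ WE].
case: W / WE h => h.
have sV : restr F (IVU n) (sval (s n)) = restr F (IV n) t := svalP (s n).
have hU : opsaI V (E n) `<=` U by apply: subset_trans h VU.
by rewrite (restr_irr h (IV n) t) -sV -(gP n (IU n)) !(restr_comp _ _ hU).
Qed.

Variables (F' F F'' : sheaf k X) (u : hom F' F) (v : hom F F'').
Hypothesis uv : short_exact u v.

(** Local preimages under u are unique, u being a monomorphism, hence they glue. *)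
Lemma exact_lift (U : opsa X) (t : F U) : v U t = 0 -> exists s, u U s = t.
Proof.
have [um ex _] := uv; move=> /ex[S cov h]; have [SU _] := cov.
pose A (i : {V | S V}) := sval i.
pose AU i : A i `<=` U := SU _ (svalP i).
pose s i : F' (A i) := sval (cid (h _ (AU i) (svalP i))).
have sE i : u (A i) (s i) = restr F (AU i) t.
  exact: svalP (cid (h _ (AU i) (svalP i))).
have cov' : covering U (range A).
  rewrite (_ : range A = S) //; apply/seteqP; split => [_ [[V SV] _ <-] //|V SV].
  by exists (exist _ V SV).
have [g gP] : exists g : F' U, forall i (h : A i `<=` U), restr F' h g = s i.
  apply: sheaf_glue cov' _ => i j W Wi Wj.
  apply/eqP; rewrite -subr_eq0; apply/eqP/um.
  rewrite linearB /= !hom_natural !sE.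
  by rewrite !(restr_comp _ _ (subset_trans Wi (AU i))) subrr.
exists g; apply: sheaf_separated cov' _ => V hV [i _ Vi]; case: V / Vi hV => hV.
by rewrite -hom_natural gP sE; exact: restr_irr.
Qed.

Hypothesis qF' : quasi_injective F'.

(** The correction is made on B only, so that the glued lift extends a; this is
    what allows the construction of compatible lifts along an exhaustion. *)
Lemma lift_pair (U A B : opsa X) (AU : A `<=` U) (BU : B `<=` U) (t : F'' U)
    (a : F A) (b : F B) :
  relatively_compact B ->
  v A a = restr F'' AU t -> v B b = restr F'' BU t ->
  exists s : F (opsaU A B), [/\ forall h, v _ s = restr F'' h t
    & forall h, restr F h s = a].
Proof.
move=> Bc va vb.
have IA : opsaI A B `<=` A by move=> x [].
have IB : opsaI A B `<=` B by move=> x [].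
have IU : opsaI A B `<=` U by apply: subset_trans IA AU.
have [|d dE] := @exact_lift _ (restr F IA a - restr F IB b).
  by rewrite linearB /= !hom_natural va vb !(restr_comp _ _ IU) subrr.
have [d' d'E] := quasi_injective_extend IB qF' Bc d.
have [s [sA sB]] : exists s : F (opsaU A B),
    (forall h, restr F h s = a) /\ (forall h, restr F h s = b + u B d').
  apply: sheaf_glue_pair => hA hB.
  rewrite linearD /= -hom_natural (restr_irr hB IB) (restr_irr hB IB) d'E dE.
  by rewrite addrC subrK; exact: restr_irr.
exists s; split => // h; apply: sheaf_separated (covering_pair A B) _ => V hV [i _ Vi].
have vu x : v B (u B x) = 0.
  have [_ ex _] := uv; apply/ex; exists [set B]; first exact: covering_self.
  by move=> V' + V'E; rewrite (V'E : V' = B) => V'B; exists x; rewrite restr_id.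
have vsA hA : restr F'' hA (v _ s) = restr F'' hA (restr F'' h t) :> F'' A.
  by rewrite -hom_natural sA va; rewrite (restr_comp _ _ AU).
have vsB hB : restr F'' hB (v _ s) = restr F'' hB (restr F'' h t) :> F'' B.
  by rewrite -hom_natural sB linearD /= vu addr0 vb; rewrite (restr_comp _ _ BU).
by case: i Vi => Vi; case: V / Vi hV => hV; [exact: vsA|exact: vsB].
Qed.

(** The finitely many sets of the cover that matter near the closure of U are
    added one at a time. *)
Lemma lift_relatively_compact (U : opsa X) (t : F'' U) :
  relatively_compact U -> exists s : F U, v U s = t.
Proof.
move=> Uc; have [_ _ /(_ U t)[S [SU SK] h]] := uv.
have [S0 [S0f S0S S0U]] := SK _ Uc.
have {}S0U : \bigcup_(V in S0) osa V = U.
  have cU : closure U `&` U = U.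
    by apply/seteqP; split => [x []//|x Ux]; split => //; exact: subset_closure.
  rewrite -[RHS]cU -S0U; apply/seteqP; split => [x [V S0V Vx]|x []//].
  split; last by exists V.
  by apply: subset_closure; apply: (SU V) => //; exact: S0S.
have H : S0 `<=` S -> exists W : opsa X, osa W = \bigcup_(V in S0) osa V /\
    exists s : F W, forall h, v W s = restr F'' h t.
  elim/finite_set_ind: S0 / S0f {S0S S0U} => [_|V A IH VA].
    exists (opsa0 X); rewrite bigcup_set0; split => //; exists 0 => h'.
    exact: sheaf_opsa0.
  have [|W [WE [s sP]]] := IH; first by move=> x Ax; apply: VA; right.
  have SV : S V by apply: VA; left.
  have VU := SU _ SV; have [b bP] := h _ VU SV.
  have WU : W `<=` U.
    by rewrite WE => x [V' AV' V'x]; apply: (SU V') => //; apply: VA; right.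
  have Vc := relatively_compactS VU Uc.
  have [s' [s'P _]] := lift_pair Vc (sP WU) bP.
  by exists (opsaU W V); split; [rewrite bigcup_setU1 setUC /= WE|exists s'].
have [W [WE [s sP]]] := H S0S.
have [UW WU] : U `<=` W /\ W `<=` U by rewrite WE S0U; split=> x.
exists (restr F UW s).
by rewrite hom_natural (sP WU) (restr_comp _ _ (@subset_refl _ U)) restr_id.
Qed.

(** Each lift over U `&` E_n.+1 is replaced by one extending the lift already
    chosen over U `&` E_n. *)
Lemma lift_global (U : opsa X) (t : F'' U) : exists s : F U, v U s = t.
Proof.
have [E [ES Ec EK]] := exhaustion X.
have IU n : opsaI U (E n) `<=` U by move=> x [].
have Ic n : relatively_compact (opsaI U (E n)).
  by apply: relatively_compactS (Ec n) => x [].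
pose T n := {s : F (opsaI U (E n)) | v _ s = restr F'' (IU n) t}.
have [s0 s0P] := lift_relatively_compact (restr F'' (IU 0%N) t) (Ic 0%N).
have step n (x : T n) : exists y : T n.+1,
    forall h, restr F h (sval y) = sval x :> F (opsaI U (E n)).
  case: x => x xP /=.
  have [b bP] := lift_relatively_compact (restr F'' (IU n.+1) t) (Ic n.+1).
  have [s [sv sx]] := lift_pair (Ic n.+1) xP bP.
  have hB : opsaI U (E n.+1) `<=` opsaU (opsaI U (E n)) (opsaI U (E n.+1)).
    by move=> y; right.
  have hA : opsaI U (E n) `<=` opsaU (opsaI U (E n)) (opsaI U (E n.+1)).
    by move=> y; left.
  have hU : opsaU (opsaI U (E n)) (opsaI U (E n.+1)) `<=` U by move=> y [] [].
  have yP : v _ (restr F hB s) = restr F'' (IU n.+1) t.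
    by rewrite hom_natural (sv hU) restr_comp.
  by exists (exist _ (restr F hB s) yP) => h /=; rewrite (restr_comp _ _ hA).
have [s sP] := dep_dependent_choice (exist _ s0 s0P : T 0%N) step.
have [g gP] := sheaf_glue_exhaustion ES EK sP.
exists g; apply: sheaf_separated (covering_exhaustion U EK) _ => W h [n _ WE].
case: W / WE h => h; rewrite -hom_natural gP.
have -> : v _ (sval (s n)) = restr F'' (IU n) t := svalP (s n).
exact: restr_irr.
Qed.

Lemma quasi_injective_quotient : quasi_injective F -> quasi_injective F''.
Proof.
move=> qF U V VU Uc Vc t; have [s st] := lift_relatively_compact t Vc.
have [s' s'E] := qF U V VU Uc Vc s.
by exists (v U s'); rewrite -hom_natural s'E.
Qed.

End Lifting.

(** * Direct images *)

Section DirectImageExact.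
Context {R : realType} {k : fieldType} {X Y : manifold R} (f : morphism X Y).

Lemma direct_image_quasi_injective (F : sheaf k X) :
  quasi_injective F -> quasi_injective (direct_image k f F).
Proof.
by move=> qF U V VU _ _ t; exact: (quasi_injective_flabby (preimS (f := f) VU) qF t).
Qed.

Lemma direct_image_short_exact (F' F F'' : sheaf k X) (u : hom F' F) (v : hom F F'') :
  short_exact u v -> quasi_injective F' ->
  short_exact (fmap (direct_image k f) u) (fmap (direct_image k f) v).
Proof.
move=> uv qF'; have [um ex _] := uv; split.
- by move=> U s; exact: um.
- move=> U t; split=> [vt|[S cov h]].
    have [s su] := exact_lift uv vt.
    exists [set U]; first exact: covering_self.
    move=> V VU _; exists (restr F' (preimS (f := f) VU) s).
    by rewrite /= hom_natural su; reflexivity.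
  apply/ex; exists (preim f @` S); first exact: covering_preim.
  move=> W WU [V SV VW]; case: W / VW WU => WU.
  have [SU _] := cov; have [s sP] := h V (SU _ SV) SV.
  by exists s; rewrite sP; exact: restr_irr.
- move=> U t; have [s st] := lift_global uv qF' (t : F'' (preim f U)).
  exists [set U]; first exact: covering_self.
  move=> V VU _; exists (restr F (preimS (f := f) VU) s).
  by rewrite /= hom_natural st; reflexivity.
Qed.

End DirectImageExact.

(** * Products and quotients of modules *)

Section DependentProduct.
Variables (k : pzRingType) (I : Type) (M : I -> lmodType k).

Definition dprod : Type := forall i, M i.

HB.instance Definition _ := gen_eqMixin dprod.
HB.instance Definition _ := gen_choiceMixin dprod.

Let zero : dprod := fun=> 0.
Let opp (x : dprod) : dprod := fun i => - x i.
Let add (x y : dprod) : dprod := fun i => x i + y i.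
Let scale (a : k) (x : dprod) : dprod := fun i => a *: x i.

Let addA : associative add.
Proof. by move=> x y z; apply: functional_extensionality_dep => i; exact: addrA. Qed.
Let addC : commutative add.
Proof. by move=> x y; apply: functional_extensionality_dep => i; exact: addrC. Qed.
Let add0 : left_id zero add.
Proof. by move=> x; apply: functional_extensionality_dep => i; exact: add0r. Qed.
Let addN : left_inverse zero opp add.
Proof. by move=> x; apply: functional_extensionality_dep => i; exact: addNr. Qed.

HB.instance Definition _ := GRing.isZmodule.Build dprod addA addC add0 addN.

Let scaleA a b v : scale a (scale b v) = scale (a * b) v.
Proof. by apply: functional_extensionality_dep => i; exact: scalerA. Qed.
Let scale1 : left_id 1 scale.
Proof. by move=> x; apply: functional_extensionality_dep => i; exact: scale1r. Qed.
Let scaleDr : right_distributive scale +%R.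
Proof. by move=> a x y; apply: functional_extensionality_dep => i; exact: scalerDr. Qed.
Let scaleDl v : {morph scale^~ v : a b / a + b}.
Proof. by move=> a b; apply: functional_extensionality_dep => i; exact: scalerDl. Qed.

HB.instance Definition _ :=
  GRing.Zmodule_isLmodule.Build k dprod scaleA scale1 scaleDr scaleDl.

End DependentProduct.

Section QuotientModule.
Local Open Scope quotient_scope.
Variables (k : pzRingType) (V : lmodType k) (N : {pred V}).
Hypothesis NP : submod_closed N.

Definition submod_zmodClosed : zmodClosed V :=
  HB.pack_for (zmodClosed V) (N : V -> bool)
    (GRing.isZmodClosed.Build V N (GRing.submod_closedB NP)).
Local Notation Q := (Quotient.quot submod_zmodClosed).

Definition quotmod : Type := Q.
HB.instance Definition _ := GRing.Zmodule.on quotmod.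

Definition quot_pi (x : V) : quotmod := \pi_Q x.

Lemma quot_piP x y : quot_pi x = quot_pi y <-> x - y \in N.
Proof.
have -> : (x - y \in N) = (x == y %[mod Q]) by rewrite -Quotient.idealrBE.
by split=> [h|/eqP//]; apply/eqP.
Qed.

Lemma quot_piD : {morph quot_pi : x y / x + y}.
Proof. by move=> x y; rewrite /quot_pi -[RHS]/(\pi_Q x + \pi_Q y) !piE. Qed.

Let scale (a : k) (x : quotmod) : quotmod := quot_pi (a *: repr (x : Q)).

Let scaleE a x : scale a (quot_pi x) = quot_pi (a *: x).
Proof.
apply/quot_piP; rewrite -scalerBr; have [N0 Nlin] := NP.
rewrite -[_ *: _]addr0; apply: Nlin => //; apply/quot_piP.
by rewrite /quot_pi reprK.
Qed.

Let quotP (P : quotmod -> Prop) : (forall x, P (quot_pi x)) -> forall x, P x.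
Proof. by move=> h x; have := h (repr (x : Q)); rewrite /quot_pi reprK. Qed.

Let scaleA a b v : scale a (scale b v) = scale (a * b) v.
Proof. by elim/quotP: v => v; rewrite !scaleE scalerA. Qed.
Let scale1 : left_id 1 scale.
Proof. by elim/quotP => v; rewrite !scaleE scale1r. Qed.
Let scaleDr : right_distributive scale +%R.
Proof.
move=> a; elim/quotP => x; elim/quotP => y.
by rewrite -quot_piD !scaleE scalerDr quot_piD.
Qed.
Let scaleDl v : {morph scale^~ v : a b / a + b}.
Proof. by elim/quotP: v => v a b; rewrite !scaleE scalerDl quot_piD. Qed.

HB.instance Definition _ :=
  GRing.Zmodule_isLmodule.Build k quotmod scaleA scale1 scaleDr scaleDl.

Let quot_pi_linear : linear quot_pi.
Proof. by move=> a x y; rewrite quot_piD -scaleE. Qed.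
HB.instance Definition _ :=
  GRing.isLinear.Build k V quotmod *:%R quot_pi quot_pi_linear.

End QuotientModule.

(** * Points of the subanalytic site *)

Section Points.
Context {R : realType} (X : manifold R).

(** A covering has finite subfamilies with the same trace on a given compact set,
    so an ultrafilter containing a relatively compact set is compatible with
    coverings ([point_covering]).  Such an ultrafilter may converge to a boundary
    point of an open set that belongs to it, and so sees sections that are
    invisible at the points of X. *)
Record point := Point {
  point_filter : set_system X;
  point_ultra : UltraFilter point_filter;
  point_rc : exists2 W : opsa X, relatively_compact W & point_filter (osa W) }.

Definition at_point (p : point) (U : opsa X) : Prop := point_filter p (osa U).
Coercion at_point : point >-> Funclass.

Lemma pointI (p : point) (U V : opsa X) : p U -> p V -> p (opsaI U V).
Proof. by rewrite /at_point; case: p => G Gu ? /=; exact: filterI. Qed.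

Lemma pointS (p : point) (U V : opsa X) : V `<=` U -> p V -> p U.
Proof. by rewrite /at_point; case: p => G Gu ? /=; exact: filterS. Qed.

Lemma ultra_bigcup (T I : Type) (G : set_system T) (S : set I) (A : I -> set T) :
  UltraFilter G -> finite_set S -> G (\bigcup_(i in S) A i) ->
  exists2 i, S i & G (A i).
Proof.
move=> Gu; move: S; apply: finite_set_ind => [|i S IH].
  by rewrite bigcup_set0 => /filter_ex[].
rewrite bigcup_setU1 => GA.
have [Gi|nGi] := in_ultra_setVsetC (A i) Gu; first by exists i => //; left.
have [|j Sj Gj] := IH; last by exists j => //; right.
by apply: filterS (filterI GA nGi) => x [[]].
Qed.

(** This is what makes p a point of the site.  Over the compact closure of W the
    covering has a finite subfamily, and an ultrafilter containing a finite union
    contains one of its terms. *)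
Lemma point_covering (p : point) (U : opsa X) (S : set (opsa X)) :
  covering U S -> p U -> exists2 V, S V & p V.
Proof.
case: p => G Gu [W Wc GW] [_ SK]; rewrite /at_point /= => GU.
have [S0 [S0f S0S S0K]] := SK _ Wc.
suff [V S0V GV] : exists2 V, S0 V & G (osa V) by exists V => //; exact: S0S.
apply: ultra_bigcup => //; apply: filterS (filterI GW GU) => x [Wx Ux].
suff : (closure W `&` \bigcup_(V in S0) osa V) x by case.
by rewrite S0K; split => //; exact: subset_closure.
Qed.

End Points.

(** * The Godement embedding *)

Section Godement.
Context {R : realType} {k : fieldType} {X : manifold R}.
Section Stalk.
Variables (F : presheaf k X) (p : point X).

(** Vanishing along p: modulo this submodule, two families of sections are equal
    as soon as they agree below some member of p. *)
Definition vanish : {pred dprod F} :=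
  fun s => `[< exists2 W : opsa X, p W & forall V : opsa X, V `<=` W -> s V = 0 >].

Lemma vanish_submod : submod_closed vanish.
Proof.
split.
  apply/asboolP; have [W _ pW] := point_rc p; exists W => // V _; reflexivity.
move=> a s t /asboolP[W1 pW1 s0] /asboolP[W2 pW2 t0].
apply/asboolP; exists (opsaI W1 W2); first exact: pointI.
move=> V VW; have -> : (a *: s + t) V = a *: s V + t V by [].
by rewrite s0 ?t0 ?scaler0 ?addr0 // => x /VW[].
Qed.

(** A module containing the colimit of F U over the members U of p; sections are
    compared inside the product of all F V, where no colimit has to be built. *)
Definition stalk : lmodType k := quotmod vanish_submod.

Definition extend0 (U : opsa X) (s : F U) : dprod F :=
  fun V => if pselect (V `<=` U) is left h then restr F h s else 0.

Lemma extend0E (U V : opsa X) (s : F U) (h : V `<=` U) : extend0 s V = restr F h s.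
Proof. by rewrite /extend0; case: pselect => // h'; exact: restr_irr. Qed.

Lemma extend0_linear U : linear (@extend0 U).
Proof.
move=> a s t; apply: functional_extensionality_dep => V.
have -> : (a *: extend0 s + extend0 t) V = a *: extend0 s V + extend0 t V by [].
by rewrite /extend0; case: pselect => h; rewrite ?linearP // scaler0 addr0.
Qed.

Definition germ (U : opsa X) (s : F U) : stalk := quot_pi vanish_submod (extend0 s).

Lemma germ_linear U : linear (@germ U).
Proof. by move=> a s t; rewrite /germ extend0_linear linearP. Qed.

Lemma germ_restr (U V : opsa X) (h : V `<=` U) (s : F U) :
  p V -> germ (restr F h s) = germ s.
Proof.
move=> pV; apply/quot_piP/asboolP; exists V => // W WV.
have -> : (extend0 (restr F h s) - extend0 s) W = extend0 (restr F h s) W - extend0 s W.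
  by [].
have WU := subset_trans WV h.
by rewrite (extend0E _ WV) (extend0E _ WU) restr_comp subrr.
Qed.

Lemma germ_eq0 (U : opsa X) (s : F U) : p U -> germ s = 0 ->
  exists2 V : opsa X, p V & exists h : V `<=` U, restr F h s = 0.
Proof.
move=> pU; have -> : 0 = quot_pi vanish_submod 0 by rewrite linear0.
move=> /quot_piP; rewrite subr0 => /asboolP[W pW W0].
have h : opsaI W U `<=` U by move=> x [].
exists (opsaI W U); first exact: pointI.
by exists h; rewrite -extend0E W0 // => x [].
Qed.

End Stalk.

Definition points_in (U : opsa X) : Type := {p : point X | p U}.

Definition points_inS (U V : opsa X) (VU : V `<=` U) (q : points_in V) : points_in U :=
  exist _ (sval q) (pointS VU (svalP q)).

Section Sheaf.
Variable F : presheaf k X.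

(** A product of stalks, so that restricting to a smaller set drops factors. *)
Definition gsections (U : opsa X) : lmodType k :=
  dprod (fun q : points_in U => stalk F (sval q)).

Definition gsections_restr (U V : opsa X) (VU : V `<=` U)
    (s : gsections U) : gsections V :=
  fun q => s (points_inS VU q).

Lemma gsections_restr_linear (U V : opsa X) (VU : V `<=` U) : linear (gsections_restr VU).
Proof. by []. Qed.

HB.instance Definition _ (U V : opsa X) (VU : V `<=` U) :=
  GRing.isLinear.Build k (gsections U) (gsections V) *:%R
    (gsections_restr VU) (gsections_restr_linear VU).

Lemma gsections_at U (s : gsections U) (p : point X) (h h' : p U) :
  s (exist _ p h) = s (exist _ p h').
Proof. by rewrite (Prop_irrelevance h h'). Qed.

Definition godement_presheaf : presheaf k X.
Proof.
refine (@Presheaf R k X gsections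
  (fun U V VU => gsections_restr VU : {linear gsections U -> gsections V}) _ _).
- move=> U UU s; apply: functional_extensionality_dep => -[p h].
  by rewrite /= /gsections_restr /points_inS /=; exact: gsections_at.
- move=> U V W VU WV WU s; apply: functional_extensionality_dep => -[p h].
  by rewrite /= /gsections_restr /points_inS /=; exact: gsections_at.
Defined.

Lemma godement_sheaf_axiom : sheaf_axiom godement_presheaf.
Proof.
move=> U S cov s sm; have [SU _] := cov.
have loc (q : points_in U) : {V | S V & sval q V}.
  by apply: cid2; exact: point_covering cov (svalP q).
pose t : gsections U := fun q => s (s2val (loc q)) (exist _ (sval q) (s2valP' (loc q))).
have sE V1 V2 (p : point X) (S1 : S V1) (S2 : S V2) (p1 : p V1) (p2 : p V2) :
    s V1 (exist _ p p1) = s V2 (exist _ p p2).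
  have I1 : opsaI V1 V2 `<=` V1 by move=> x [].
  have I2 : opsaI V1 V2 `<=` V2 by move=> x [].
  have := congr1 (fun g : gsections _ => g (exist _ p (pointI p1 p2)))
                 (sm _ _ _ S1 S2 I1 I2).
  by rewrite /= /gsections_restr /points_inS /= (gsections_at _ _ p1) (gsections_at _ _ p2).
exists t; split.
  move=> V VU SV; apply: functional_extensionality_dep => -[p pV].
  rewrite /= /gsections_restr /t /=; apply: sE => //; exact: s2valP.
move=> t' t'P; apply: functional_extensionality_dep => -[p pU].
rewrite /t /=; case: (loc _) => V SV /= pV.
rewrite -(t'P V (SU V SV) SV) /= /gsections_restr /points_inS /=; exact: gsections_at.
Qed.

Definition godement : sheaf k X := Sheaf godement_sheaf_axiom.

Lemma godement_quasi_injective : quasi_injective godement.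
Proof.
move=> U V VU _ _ t.
exists (fun q : points_in U => match pselect (sval q V) return stalk F (sval q) with
  | left h => t (exist _ (sval q) h) | right _ => 0 end).
apply: functional_extensionality_dep => -[p pV]; rewrite /= /gsections_restr /=.
by case: pselect => // h; exact: gsections_at.
Qed.

End Sheaf.

Section Unit.
Variable F : sheaf k X.

Definition unit_at (U : opsa X) (s : F U) : gsections F U := fun q => germ (sval q) s.

Lemma unit_at_linear U : linear (@unit_at U).
Proof.
by move=> a s t; apply: functional_extensionality_dep => q; exact: germ_linear.
Qed.

HB.instance Definition _ (U : opsa X) :=
  GRing.isLinear.Build k (F U) (gsections F U) *:%R (@unit_at U) (@unit_at_linear U).

Definition godement_unit : hom F (godement F).
Proof.
refine (@Hom R k X F (godement F) (fun U => @unit_at U : {linear F U -> gsections F U}) _).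
move=> U V VU s; apply: functional_extensionality_dep => -[p pV].
exact: germ_restr.
Defined.

(** The sets V on which s vanishes are stable under finite unions because F is a
    sheaf, and none of them is U; so their complements in U generate a proper
    filter. *)
Lemma separating_point (U : opsa X) (s : F U) :
  relatively_compact U -> s <> 0 ->
  exists2 p : point X, p U & forall (V : opsa X) (h : V `<=` U), p V -> restr F h s <> 0.
Proof.
move=> Uc s0.
pose D := [set V : opsa X | exists h : V `<=` U, restr F h s = 0].
have GF : ProperFilter (filter_from D (fun V : opsa X => osa U `\` osa V)).
  apply: filter_from_proper; first apply: filter_from_filter.
  - exists (opsa0 X); have h : opsa0 X `<=` U by [].
    by exists h; exact: sheaf_opsa0.
  - move=> V1 V2 [h1 z1] [h2 z2]; exists (opsaU V1 V2); last first.
      by move=> x [Ux nV]; split; split => // Vx; apply: nV; [left|right].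
    have h : opsaU V1 V2 `<=` U by move=> x [/h1|/h2].
    exists h; apply: sheaf_separated (covering_pair V1 V2) _ => V hV [b _ Vb].
    have hVU := subset_trans hV h; rewrite linear0 (restr_comp _ _ hVU).
    case: b Vb => Vb; case: V / Vb hV hVU => hV hVU.
      by rewrite (restr_irr hVU h1).
    by rewrite (restr_irr hVU h2).
  - move=> V [h z]; apply: contrapT => nx; apply: s0.
    have UV : U `<=` V.
      by move=> x Ux; apply: contrapT => nVx; apply: nx; exists x.
    by rewrite -(restr_id (@subset_refl _ U) s) -(restr_comp h UV) z linear0.
have [G [Gu FG]] := ultraFilterLemma GF.
have GU : G (osa U).
  apply: FG; exists (opsa0 X); last by move=> x [].
  by have h : opsa0 X `<=` U by []; exists h; exact: sheaf_opsa0.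
exists (Point Gu (ex_intro2 _ _ U Uc GU)) => // V h /= GV z.
have : G (osa U `\` osa V) by apply: FG; exists V => //; exists h.
by move=> /(filterI GV)/filter_ex[x [Vx [_ nVx]]]; exact: nVx.
Qed.

Lemma godement_unit_monic : monic godement_unit.
Proof.
move=> U s us0; have [E [_ Ec EK]] := exhaustion X.
apply: sheaf_separated (covering_exhaustion U EK) _ => V VU [n _ VE].
have Vc : relatively_compact V by apply: relatively_compactS (Ec n); rewrite -VE => x [].
rewrite linear0; apply: contrapT => sV0.
have [p pV pP] := separating_point Vc sV0.
have [W pW [WU sW0]] : exists2 W : opsa X, p W & exists h : W `<=` U, restr F h s = 0.
  apply: germ_eq0; first exact: pointS VU pV.
  exact: (congr1 (fun t : gsections F U => t (exist _ p (pointS VU pV))) us0).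
have IV : opsaI W V `<=` V by move=> x [].
have IW : opsaI W V `<=` W by move=> x [].
have IU : opsaI W V `<=` U by exact: subset_trans IV VU.
apply: (pP (opsaI W V) IV); first exact: pointI.
by rewrite (restr_comp _ _ IU) -(restr_comp WU IW) sW0 linear0.
Qed.

End Unit.
End Godement.

(** * Injectivity with respect to the direct image *)

Theorem proposition1p5p10 (R : realType) (k : fieldType) (X Y : manifold R)
    (f : morphism X Y) :
  injective_wrt (@quasi_injective R k X) (direct_image k f) /\
  (forall F : sheaf k X, quasi_injective F -> quasi_injective (direct_image k f F)).
Proof.
split; last by move=> F; exact: direct_image_quasi_injective.
split.
- move=> F; exists (godement F), (godement_unit F); split.
    exact: godement_quasi_injective.
  exact: godement_unit_monic.
- by move=> F' F F'' u v uv qF'; exact: (quasi_injective_quotient uv).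
- by move=> F' F F'' u v uv qF' _ _; exact: direct_image_short_exact.
Qed.
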